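(* Assume the ABC conjecture. Let $\tfrac{p}{q}$ be a rational number with $\tfrac14 \le \tfrac{p}{q} < \tfrac12$. Then there are constants $c_1, c_2>0$ and infinitely many totally real cyclic quartic number fields $K$ such that \[ c_1 D_K^{p/q} \le M(\mathcal{O}_K) \le c_2 D_K^{p/q}. \]
   Context: For a nonconstant polynomial $f(x)=c\prod_{i=1}^d (x-\alpha_i)\in\mathbb{C}[x]$, the Mahler measure is $M(f)=|c|\prod_{|\alpha_i|\ge 1}|\alpha_i|$. For an algebraic number $\alpha$, $M(\alpha)$ is the Mahler measure of its minimal polynomial over $\mathbb{Z}$ (with content $1$). For a number field $K$ with ring of integers $\mathcal{O}_K$ and absolute discriminant $D_K$, $M(\mathcal{O}_K)=\min\{M(\alpha):\alpha\in\mathcal{O}_K,\ \mathbb{Q}(\alpha)=K\}$. A cyclic quartic field is a Galois quartic field with Galois group $\mathbb{Z}/4\mathbb{Z}$. *)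

(* Defs.v *)
From HB Require Import structures.
From mathcomp Require Import all_boot all_order all_algebra all_field.
Set Implicit Arguments. Unset Strict Implicit. Unset Printing Implicit Defensive.
Import Order.TTheory GRing.Theory Num.Theory.
Local Open Scope ring_scope.

(* All number fields are realised as subfields of algC (the algebraic closure
   of Q inside C, with its complex absolute value and partial order). *)

Definition nfield (theta : algC) : algC -> Prop :=
  fun x => exists p : {poly rat}, x = (map_poly ratr p).[theta].

Definition nf_degree (theta : algC) : nat := (size (minCpoly theta)).-1.

Definition alg_int (x : algC) : Prop :=
  exists p : {poly int}, p \is monic /\ root (map_poly intr p) x.

Definition ring_of_int (K : algC -> Prop) (x : algC) : Prop := K x /\ alg_int x.

(* Field embeddings K -> C (given as functions on algC, only their values on K
   matter). *)
Definition embedding (K : algC -> Prop) (s : algC -> algC) : Prop :=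
  s 1 = 1 /\
  (forall x y, K x -> K y -> s (x + y) = s x + s y) /\
  (forall x y, K x -> K y -> s (x * y) = s x * s y).

(* Field automorphisms of K (automatically Q-linear). *)
Definition automorphism (K : algC -> Prop) (s : algC -> algC) : Prop :=
  embedding K s /\ (forall x, K x -> K (s x)) /\
  (forall y, K y -> exists x, K x /\ s x = y).

Definition totally_real (K : algC -> Prop) : Prop :=
  forall s, embedding K s -> forall x, K x -> s x \is Num.real.

(* Cyclic quartic field Q(theta): degree 4, and Aut(K/Q) is cyclic of order 4
   (hence |Aut(K/Q)| = [K:Q], so K/Q is Galois with group Z/4Z). *)
Definition cyclic_quartic (theta : algC) : Prop :=
  let K := nfield theta in
  nf_degree theta = 4%N /\
  exists s, automorphism K s /\
    (forall i j : 'I_4, i <> j -> exists x, K x /\ iter i s x <> iter j s x) /\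
    (forall t, automorphism K t -> exists i : 'I_4, forall x, K x -> t x = iter i s x).

Definition abs_disc (K : algC -> Prop) (D : algC) : Prop :=
  exists (n : nat) (b : 'I_n -> algC) (s : 'I_n -> algC -> algC),
    (forall i, ring_of_int K (b i)) /\
    (forall y, ring_of_int K y ->
        exists c : 'I_n -> int, y = \sum_i (c i)%:~R * b i /\
          forall c' : 'I_n -> int, y = \sum_i (c' i)%:~R * b i -> c' =1 c) /\
    (forall j, embedding K (s j)) /\
    (forall j j', j <> j' -> exists x, K x /\ s j x <> s j' x) /\
    D = `| (\det (\matrix_(i, j) s j (b i))) ^+ 2 |.

Definition rootsC (f : {poly algC}) : seq algC := sval (closed_field_poly_normal f).

Definition mahler (f : {poly algC}) : algC :=
  `|lead_coef f| * \prod_(z <- rootsC f | 1 <= `|z|) `|z|.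

(* p is the minimal polynomial of alpha over Z with content 1 (and positive
   leading coefficient: zcontents p carries the sign of lead_coef p). *)
Definition minZpoly (alpha : algC) (p : {poly int}) : Prop :=
  p != 0 /\ root (map_poly intr p) alpha /\ zcontents p = 1 /\
  forall q : {poly int}, q != 0 -> root (map_poly intr q) alpha -> (size p <= size q)%N.

Definition mahler_alg (alpha m : algC) : Prop :=
  exists p, minZpoly alpha p /\ m = mahler (map_poly intr p).

Definition mahler_OK (K : algC -> Prop) (m : algC) : Prop :=
  (exists alpha, ring_of_int K alpha /\ (forall x, nfield alpha x <-> K x) /\
                 mahler_alg alpha m) /\
  (forall beta m', ring_of_int K beta -> (forall x, nfield beta x <-> K x) ->
                   mahler_alg beta m' -> m <= m').

(* x ^ r for x >= 0 real and r >= 0 rational: ((denq r)-th root of x)^(numq r). *)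
Definition rpow (x : algC) (r : rat) : algC := (`|denq r|%N).-root x ^+ `|numq r|%N.

Definition rad (n : nat) : nat := \prod_(p <- primes n) p.

(* The ABC conjecture: for every eps > 0 there is K_eps > 0 such that for all
   coprime positive integers a, b, c with a + b = c, c <= K_eps rad(abc)^(1+eps).
   (eps ranges over positive rationals, which is equivalent by monotonicity.) *)
Definition ABC : Prop :=
  forall eps : rat, 0 < eps -> exists Ke : algC, 0 < Ke /\
    forall a b c : nat, (0 < a)%N -> (0 < b)%N -> coprime a b -> a + b = c ->
      (c%:R : algC) <= Ke * rpow (rad (a * b * c))%:R (1 + eps).

(* Main.v *)
Require Import Defs.
From HB Require Import structures.
From mathcomp Require Import all_boot all_order all_algebra all_field.
From mathcomp Require Import ring lra zify.
From Stdlib Require Import ClassicalEpsilon.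
Import Order.TTheory GRing.Theory Num.Theory.
Local Open Scope ring_scope.

Set Implicit Arguments. Unset Strict Implicit. Unset Printing Implicit Defensive.

(* The fields are Q(t) with t = sqrt (A (D + B s)), s = sqrt D and D = B ^ 2 + 1, where A and B
   are odd and A D is squarefree: they are cyclic quartic, with integers Z[s] + Z[s] t and
   discriminant 256 A ^ 2 D ^ 3. For a generator, the product of the differences of its two
   pairs of conjugates over Q(s) is a nonzero multiple of 4 A s, so its Mahler measure is at
   least A s. Conversely, let t' = (s - B) t, a conjugate of t with t t' = A s. If
   A = 2 y ^ 2 + k and |k s - A| <= C y, then t - t' is within C of 2 y s, so that for x close
   to (t + t') / 2 the generator x + y s - t has two bounded conjugates, the other two being of
   the size of t and t'. Thus M(O_K) has the order of A B and D_K that of A ^ 2 B ^ 6, and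
   B ~ T ^ (q - 2 p), A ~ T ^ (6 p - q) give M(O_K) ~ D_K ^ (p / q).
   Suitable A and B are found by a sieve averaged over the free parameters, in which the number
   of conditions p ^ 2 | A, p ^ 2 | D and p | gcd (A, D) that hold is less than the number of
   candidates. With B ~ T ^ m and A ~ T ^ n there are three cases: for m <= n < 2 m, k is a fixed
   power of 5 and B runs over the interval left free by A; for n = 2 m, A is a quadratic
   polynomial in B; for n > 2 m, k runs over the interval left free by B and y, and the primes
   p > T ^ (n - 2 m) are handled by bounding how often a given value of A is taken. *)

(** * Number fields and their embeddings *)

Section NumberField.

Variable theta : algC.

Lemma nfield_horner (p : {poly rat}) x :
  nfield theta x -> nfield theta (map_poly ratr p).[x].
Proof. by move=> [q ->]; exists (p \Po q); rewrite map_comp_poly horner_comp. Qed.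

Lemma nfield_gen : nfield theta theta.
Proof. by exists 'X; rewrite map_polyX hornerX. Qed.

Lemma nfield_rat a : nfield theta (ratr a).
Proof. by exists a%:P; rewrite map_polyC hornerC. Qed.

Lemma nfieldD x y : nfield theta x -> nfield theta y -> nfield theta (x + y).
Proof. by move=> [p ->] [q ->]; exists (p + q); rewrite rmorphD hornerD. Qed.

Lemma nfieldM x y : nfield theta x -> nfield theta y -> nfield theta (x * y).
Proof. by move=> [p ->] [q ->]; exists (p * q); rewrite rmorphM hornerM. Qed.

Lemma nf_degree_lt_size (p : {poly rat}) :
  p != 0 -> root (map_poly ratr p) theta -> (nf_degree theta < size p)%N.
Proof.
move=> p_neq0; rewrite /nf_degree; have [m [-> m_monic] ->] := minCpolyP theta.
rewrite size_map_poly => /(dvdp_leq p_neq0).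
by rewrite prednK // size_poly_gt0 monic_neq0.
Qed.

Lemma nf_degreeE n (p : {poly rat}) :
    p != 0 -> root (map_poly ratr p) theta -> size p = n.+1 ->
    (forall q : {poly rat}, q != 0 -> root (map_poly ratr q) theta -> (n < size q)%N) ->
  nf_degree theta = n.
Proof.
move=> p_neq0 p_root p_size p_min; apply/eqP; rewrite eqn_leq -ltnS -p_size.
rewrite nf_degree_lt_size //=; have [m [mE m_monic] _] := minCpolyP theta.
have m_root : root (map_poly ratr m) theta by rewrite -mE root_minCpoly.
rewrite /nf_degree mE size_map_poly -ltnS prednK ?size_poly_gt0 ?monic_neq0 //.
by rewrite p_min ?monic_neq0.
Qed.

Lemma nfield_rVpoly x : nfield theta x ->
  exists v : 'rV[rat]_(nf_degree theta), x = (map_poly ratr (rVpoly v)).[theta].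
Proof.
move=> [p ->]; have [m [mE m_monic] _] := minCpolyP theta.
have m_neq0 := monic_neq0 m_monic.
have m_root : (map_poly ratr m).[theta] = 0 by apply/eqP; rewrite -mE -rootE root_minCpoly.
have modp_size : (size (p %% m)%R <= nf_degree theta)%N.
  by rewrite /nf_degree mE size_map_poly -ltnS prednK ?size_poly_gt0 // ltn_modp.
exists (poly_rV (p %% m)); rewrite poly_rV_K //.
by rewrite {1}(divp_eq p m) rmorphD rmorphM hornerD hornerM m_root mulr0 add0r.
Qed.

End NumberField.

Lemma nfield_sub theta theta' x :
  nfield theta theta' -> nfield theta' x -> nfield theta x.
Proof. by move=> K_theta' [p ->]; apply: nfield_horner. Qed.

Lemma nfield_eq_of_degree theta theta' :
    nfield theta theta' -> nf_degree theta' = nf_degree theta ->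
  forall x, nfield theta' x <-> nfield theta x.
Proof.
move=> K_theta' deg_eq x; split; first exact: nfield_sub.
have pow_coords (i : 'I_(nf_degree theta)) : exists v : 'rV[rat]_(nf_degree theta),
    theta' ^+ i = (map_poly ratr (rVpoly v)).[theta].
  apply: nfield_rVpoly; have := nfield_horner 'X^i K_theta'.
  by rewrite map_polyXn hornerXn.
pose M := \matrix_i proj1_sig (constructive_indefinite_description _ (pow_coords i)).
have horner_mulM (v : 'rV[rat]_(nf_degree theta)) :
    (map_poly ratr (rVpoly (v *m M))).[theta] = (map_poly ratr (rVpoly v)).[theta'].
  rewrite mulmx_sum_row linear_sum rmorph_sum horner_sum /=.
  rewrite (@horner_coef_wide _ (nf_degree theta)) ?size_map_poly ?size_poly //.
  apply: eq_bigr => i _; rewrite linearZ /= linearZ hornerZ coef_map coef_rVpoly_ord rowK /=.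
  by case: constructive_indefinite_description => u /= <-.
have M_unit : M \in unitmx.
  rewrite -row_free_unit; apply: inj_row_free => v vM0.
  have [v0|v_neq0] := eqVneq (rVpoly v) 0; first by rewrite -[v]rVpolyK v0 linear0.
  have v_root : root (map_poly ratr (rVpoly v)) theta'.
    by rewrite rootE -horner_mulM vM0 linear0 rmorph0 horner0.
  by have := nf_degree_lt_size v_neq0 v_root; rewrite deg_eq ltnNge size_poly.
move=> /nfield_rVpoly [v ->]; exists (rVpoly (v *m invmx M)).
by rewrite -horner_mulM mulmxKV.
Qed.

Section Embedding.

Variables (theta : algC) (s : algC -> algC).
Hypothesis s_emb : embedding (nfield theta) s.

Lemma embedding_rat a : s (ratr a) = ratr a.
Proof.
have [s1 [sD sM]] := s_emb; have K_rat b := nfield_rat theta b.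
have sr_nmod : nmod_morphism (s \o ratr).
  split=> [|b c] /=; last by rewrite rmorphD; apply: sD; apply: K_rat.
  by apply: (addIr (s (ratr 0))); rewrite -(sD _ _ (K_rat 0) (K_rat 0)) -rmorphD !add0r.
have sr_monoid : monoid_morphism (s \o ratr).
  by split=> [|b c] /=; rewrite ?rmorph1 // rmorphM; apply: sM; apply: K_rat.
pose sr_additive := GRing.isNmodMorphism.Build rat algC (s \o ratr) sr_nmod.
pose sr_multiplicative := GRing.isMonoidMorphism.Build rat algC (s \o ratr) sr_monoid.
pose sr : {rmorphism rat -> algC} := HB.pack (s \o ratr) sr_additive sr_multiplicative.
exact: (fmorph_eq_rat sr).
Qed.

Lemma embedding_horner (p : {poly rat}) x :
  nfield theta x -> s (map_poly ratr p).[x] = (map_poly ratr p).[s x].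
Proof.
move=> Kx; have [_ [sD sM]] := s_emb.
elim/poly_ind: p => [|p c IHp].
  by rewrite rmorph0 !horner0; have := embedding_rat 0; rewrite rmorph0.
rewrite rmorphD rmorphM /= map_polyX map_polyC /= !hornerMXaddC -IHp.
have Kp := nfield_horner p Kx; have Kpx := nfieldM Kp Kx.
by rewrite -[X in _ = _ + X]embedding_rat -(sM _ _ Kp Kx) -(sD _ _ Kpx (nfield_rat theta c)).
Qed.

End Embedding.

Definition sqfree (m : nat) : Prop := forall p, prime p -> ~~ (p ^ 2 %| m)%N.

Lemma sqfree_prime p : prime p -> sqfree p.
Proof.
move=> p_pr q q_pr; apply/negP => q2_dvd_p.
have /eqP qE : q == p.
  by rewrite -dvdn_prime2 //; apply: dvdn_trans q2_dvd_p; apply: dvdn_exp.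
by move: q2_dvd_p; rewrite qE gtnNdvd ?prime_gt0 // ltn_Pmulr ?prime_gt1 ?prime_gt0.
Qed.

Lemma sqfreeM m n : coprime m n -> sqfree m -> sqfree n -> sqfree (m * n).
Proof.
move=> co_mn m_sqf n_sqf p p_pr; apply/negP => p2mn.
have [pm|npm] := boolP (p %| m)%N.
  case/negP: (m_sqf p p_pr); rewrite -(@Gauss_dvdl _ _ n) //.
  by rewrite coprime_pexpl //; apply: coprime_dvdl pm co_mn.
case/negP: (n_sqf p p_pr); rewrite -(@Gauss_dvdr _ m) //.
by rewrite coprime_pexpl // prime_coprime.
Qed.

Lemma sqfree_mul_sqr_int (m : nat) (r : rat) :
  sqfree m -> m%:R * r ^+ 2 \in Num.int -> r \in Num.int.
Proof.
move=> m_sqf /intrP[z mr2E].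
have den_neq0 : (denq r)%:~R != 0 :> rat by rewrite intr_eq0 denq_eq0.
have num_den : (m%:Z * numq r ^+ 2 = z * denq r ^+ 2)%R.
  apply: (@intr_inj rat); rewrite !(rmorphM, rmorphXn) /= -mr2E -{2}(divq_num_den r).
  by field.
have den2_dvd : (`|denq r| ^ 2 %| m)%N.
  rewrite -(@Gauss_dvdl _ _ (`|numq r| ^ 2)); last first.
    by rewrite coprime_pexpl // coprime_pexpr // coprime_sym coprime_num_den.
  by have := congr1 absz num_den; rewrite !abszM !mulnn => ->; apply: dvdn_mull.
have [den1|den_neq1] := eqVneq `|denq r|%N 1%N.
  apply/intrP; exists (numq r); rewrite -{1}(divq_num_den r) -(gez0_abs (denq_ge0 r)) den1.
  by rewrite divr1.
have den_pdiv : prime (pdiv `|denq r|).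
  by rewrite pdiv_prime // ltn_neqAle eq_sym den_neq1 absz_gt0 denq_neq0.
case/negP: (m_sqf _ den_pdiv); apply: dvdn_trans den2_dvd.
by rewrite dvdn_exp2r // pdiv_dvd.
Qed.

Lemma rat_sqr_int (r : rat) : r ^+ 2 \in Num.int -> r \in Num.int.
Proof.
move=> r2_int; apply: (@sqfree_mul_sqr_int 1); last by rewrite mul1r.
by move=> p p_pr; rewrite dvdn1 -(exp1n 2) eqn_exp2r // neq_ltn prime_gt1 ?orbT.
Qed.

Lemma sqr_succ_not_sqr (B : nat) (r : rat) : (0 < B)%N -> r ^+ 2 != (B ^ 2 + 1)%:R.
Proof.
move=> B_gt0; apply/eqP => r2E.
have /intrP[z rE] : r \in Num.int by apply: rat_sqr_int; rewrite r2E rpred_nat.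
move: r2E; rewrite rE -rmorphXn /= pmulrn => /eqP; rewrite eqr_int => /eqP z2E.
have : (`|z| ^ 2 = B ^ 2 + 1)%N by have := congr1 absz z2E; rewrite abszX.
rewrite -!mulnn; move: `|z|%N => w w2E.
by have [wB|Bw] := leqP w B; nia.
Qed.

Lemma rat_norm_eq0 (B : nat) (a b : rat) :
  (0 < B)%N -> a ^+ 2 = (B ^ 2 + 1)%:R * b ^+ 2 -> a = 0 /\ b = 0.
Proof.
move=> B_gt0 normE; have [b0|b_neq0] := eqVneq b 0.
  by split=> //; apply/eqP; rewrite -sqrf_eq0 normE b0 expr0n mulr0.
case/eqP: (sqr_succ_not_sqr (a / b) B_gt0).
by rewrite expr_div_n normE mulfK // sqrf_eq0.
Qed.

(** * The cyclic quartic fields *)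

(* A frame is a pair of roots s = sqrt D, t = sqrt (A (D + B s)) with D = B ^ 2 + 1; the
   quadruple (a, b, c, d) stands for a + b s + (c + d s) t. Since (D - B s) (D + B s) = D, the
   other roots of A (D - B s) are +- (s - B) t, so Q(t) is Galois over Q. *)
Definition frame (A B : nat) (f : algC * algC) : Prop :=
  f.1 ^+ 2 = (B ^ 2 + 1)%:R /\ f.2 ^+ 2 = A%:R * ((B ^ 2 + 1)%:R + B%:R * f.1).

Definition quad (R : Type) : Type := (R * R * R * R)%type.

Definition quad_map (R S : Type) (h : R -> S) (q : quad R) : quad S :=
  let: (a, b, c, d) := q in (h a, h b, h c, h d).

Definition quad_eval (f : algC * algC) (q : quad rat) : algC :=
  let: (a, b, c, d) := q in
  ratr a + ratr b * f.1 + (ratr c + ratr d * f.1) * f.2.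

Definition quad_add (x y : quad rat) : quad rat :=
  let: (a, b, c, d) := x in let: (a', b', c', d') := y in
  (a + a', b + b', c + c', d + d').

Definition quad_mul (A B : nat) (x y : quad rat) : quad rat :=
  let: (a, b, c, d) := x in let: (a', b', c', d') := y in
  let D : rat := (B ^ 2 + 1)%:R in
  let P := c * c' + D * (d * d') in let Q := c * d' + d * c' in
  (a * a' + D * (b * b') + A%:R * D * (P + Q * B%:R),
   a * b' + b * a' + A%:R * (P * B%:R + Q * D),
   a * c' + D * (b * d') + (c * a' + D * (d * b')),
   a * d' + b * c' + (c * b' + d * a')).

Definition frame_conj (B : nat) (f : algC * algC) : algC * algC :=
  (- f.1, (f.1 - B%:R) * f.2).

Definition quad_conj (B : nat) (q : quad rat) : quad rat :=
  let: (a, b, c, d) := q in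
  (a, - b, - (c * B%:R + d * (B ^ 2 + 1)%:R), c + d * B%:R).

Definition quad_generating (R : nmodType) (q : quad R) : bool :=
  let: (a, b, c, d) := q in (c, d) != (0, 0).

Lemma quad_evalD f x y : quad_eval f (quad_add x y) = quad_eval f x + quad_eval f y.
Proof. by case: x => [[[a b] c] d]; case: y => [[[a' b'] c'] d'] /=; ring. Qed.

Lemma quad_evalM A B f x y :
  frame A B f -> quad_eval f (quad_mul A B x y) = quad_eval f x * quad_eval f y.
Proof.
case: f => s t [/= s2 t2].
by case: x => [[[a b] c] d]; case: y => [[[a' b'] c'] d'] /=; ring: s2 t2.
Qed.

Lemma quad_eval_rat f a : quad_eval f (a, 0, 0, 0) = ratr a.
Proof. by rewrite /=; ring. Qed.

Lemma quad_eval_snd f : quad_eval f (0, 0, 1, 0) = f.2.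
Proof. by rewrite /=; ring. Qed.

Lemma frame_conjP A B f : frame A B f -> frame A B (frame_conj B f).
Proof. by case: f => s t [/= s2 t2]; split => /=; ring: s2 t2. Qed.

Lemma frame_iter_conj A B f i : frame A B f -> frame A B (iter i (frame_conj B) f).
Proof. by move=> f_frame; elim: i => //= i; apply: frame_conjP. Qed.

Lemma quad_eval_conj A B f q :
  frame A B f -> quad_eval (frame_conj B f) q = quad_eval f (quad_conj B q).
Proof. by case: f => s t [/= s2 t2]; case: q => [[[a b] c] d] /=; ring: s2 t2. Qed.

Lemma quad_eval_iter_conj A B f q i : frame A B f ->
  quad_eval (iter i (frame_conj B) f) q = quad_eval f (iter i (quad_conj B) q).
Proof.
move=> f_frame; elim: i q => // i IHi q.
by rewrite iterS (quad_eval_conj _ (frame_iter_conj i f_frame)) IHi iterSr.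
Qed.

Lemma frame_conj2 A B f : frame A B f -> iter 2 (frame_conj B) f = (f.1, - f.2).
Proof. by case: f => s t [/= s2 _]; rewrite /frame_conj /=; congr pair; ring: s2. Qed.

Lemma quad_conj2 B a b c d : iter 2 (quad_conj B) (a, b, c, d) = (a, b, - c, - d).
Proof. by rewrite /=; congr (_, _, _, _); ring. Qed.

Lemma quad_conj4 B q : iter 4 (quad_conj B) q = q.
Proof. by case: q => [[[a b] c] d]; rewrite (iterD 2 2) !quad_conj2 !opprK. Qed.

Lemma frame_exhaustive A B f g : frame A B f -> frame A B g ->
  exists i : 'I_4, g = iter i (frame_conj B) f.
Proof.
move=> f_frame [g1E g2E]; have [f1E f2E] := f_frame.
have conjE : ((f.1 - B%:R) * f.2) ^+ 2 = A%:R * ((B ^ 2 + 1)%:R - B%:R * f.1).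
  by have [_ /= ->] := frame_conjP f_frame; rewrite mulrN.
have conj3E : iter 3 (frame_conj B) f = (- f.1, - ((f.1 - B%:R) * f.2)).
  by rewrite (iterS 2) (frame_conj2 f_frame) /frame_conj /= mulrN.
move/eqP: g1E; rewrite -f1E eqf_sqr => /orP[]/eqP g1E; rewrite g1E in g2E.
  move/eqP: g2E; rewrite -f2E eqf_sqr => /orP[]/eqP g2E.
    by exists (inord 0); rewrite inordK //= [LHS]surjective_pairing g1E g2E -surjective_pairing.
  by exists (inord 2); rewrite inordK // (frame_conj2 f_frame) [LHS]surjective_pairing g1E g2E.
rewrite mulrN -conjE in g2E.
move/eqP: g2E; rewrite eqf_sqr => /orP[]/eqP g2E.
  by exists (inord 1); rewrite inordK //= [LHS]surjective_pairing g1E g2E.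
by exists (inord 3); rewrite inordK // conj3E [LHS]surjective_pairing g1E g2E.
Qed.

Lemma quad_conj2_generating B q : quad_generating q -> iter 2 (quad_conj B) q != q.
Proof.
case: q => [[[a b] c] d]; rewrite quad_conj2; apply: contra => /eqP[cE dE].
by rewrite xpair_eqE; apply/andP; split; apply/eqP; lra.
Qed.

(* If some proper power of the conjugation fixed q, then so would its square. *)
Lemma quad_conj_uniq B q : quad_generating q -> uniq (traject (quad_conj B) q 4).
Proof.
move/(quad_conj2_generating B) => q2; rewrite looping_uniq /looping.
have q4 := quad_conj4 B q; set h := quad_conj B in q2 q4 *.
apply: contra q2 => /trajectP[[|[|[|i]]] // _ /(congr1 h)]; rewrite -iterS q4 /= => qE.
- by rewrite -!qE.
- by rewrite -qE.
- have hq : h q = q by rewrite {1}qE; exact: q4.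
  by rewrite !hq.
Qed.

Section FrameField.

Variables (A B : nat).
Hypotheses (A_gt0 : (0 < A)%N) (B_gt0 : (0 < B)%N).

Local Notation D := (B ^ 2 + 1)%N.

Lemma ratr_sqrt_free (s : algC) (a b : rat) :
  s ^+ 2 = D%:R -> ratr a + ratr b * s = 0 -> a = 0 /\ b = 0.
Proof.
move=> s2 /eqP; rewrite addr_eq0 => /eqP abE; apply: (rat_norm_eq0 B_gt0).
apply: (fmorph_inj (ratr : rat -> algC)); rewrite rmorphXn rmorphM rmorphXn /= abE.
by rewrite rmorph_nat -s2; ring.
Qed.

Lemma quad_eval_eq0 f q : frame A B f -> quad_eval f q = 0 -> q = (0, 0, 0, 0).
Proof.
case: f => s t [/= s2 t2]; case: q => [[[a b] c] d] /= q0.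
have A_neq0 : (A%:R : rat) != 0 by rewrite pnatr_eq0 -lt0n.
pose P := A%:R * (D%:R * (c ^+ 2 + D%:R * d ^+ 2) + 2 * c * d * B%:R * D%:R).
pose Q := A%:R * (B%:R * (c ^+ 2 + D%:R * d ^+ 2) + 2 * c * d * D%:R).
have relnorm0 : ratr (a ^+ 2 + D%:R * b ^+ 2 - P) + ratr (2 * a * b - Q) * s = 0.
  transitivity ((ratr a + ratr b * s + (ratr c + ratr d * s) * t) *
     (ratr a + ratr b * s - (ratr c + ratr d * s) * t)); last by rewrite q0 mul0r.
  by rewrite /P /Q; ring: s2 t2.
have [/subr0_eq PE /subr0_eq QE] := ratr_sqrt_free s2 relnorm0.
have normE : (a ^+ 2 - D%:R * b ^+ 2) ^+ 2 = D%:R * (A%:R * (c ^+ 2 - D%:R * d ^+ 2)) ^+ 2.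
  transitivity ((a ^+ 2 + D%:R * b ^+ 2) ^+ 2 - D%:R * (2 * a * b) ^+ 2); first by ring.
  by rewrite PE QE /P /Q; ring.
have [_ /eqP] := rat_norm_eq0 B_gt0 normE.
rewrite mulf_eq0 (negPf A_neq0) => /eqP /subr0_eq /(rat_norm_eq0 B_gt0)[c0 d0].
have [|-> ->] := @ratr_sqrt_free s a b s2; last by rewrite c0 d0.
by rewrite -[RHS]q0 c0 d0; ring.
Qed.

Lemma quad_eval_inj f : frame A B f -> injective (quad_eval f).
Proof.
move=> f_frame [[[a b] c] d] [[[a' b'] c'] d'] qE.
have /(quad_eval_eq0 f_frame) : quad_eval f (a - a', b - b', c - c', d - d') = 0.
  by move/eqP: qE; rewrite -subr_eq0 => /eqP <- /=; ring.
by case=> /subr0_eq -> /subr0_eq -> /subr0_eq -> /subr0_eq ->.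
Qed.

Lemma horner_quad_eval (p : {poly rat}) f q : frame A B f ->
  exists q', (map_poly ratr p).[quad_eval f q] = quad_eval f q'.
Proof.
move=> f_frame; elim/poly_ind: p => [|p c [q' IHp]].
  by exists (0, 0, 0, 0); rewrite rmorph0 horner0 quad_eval_rat rmorph0.
exists (quad_add (quad_mul A B q' q) (c, 0, 0, 0)).
rewrite rmorphD rmorphM /= map_polyX map_polyC /= hornerMXaddC IHp quad_evalD.
by rewrite (quad_evalM _ _ f_frame) quad_eval_rat.
Qed.

Definition frame_fst_poly : {poly rat} :=
  (B%:R^-1)%:P * ((A%:R^-1)%:P * ('X * 'X) - (D%:R)%:P).

Lemma horner_frame_fst (t : algC) : (map_poly ratr frame_fst_poly).[t] =
  B%:R^-1 * (A%:R^-1 * t ^+ 2 - D%:R).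
Proof.
rewrite !(rmorphM, rmorphB) /= !map_polyC /= map_polyX !hornerE /=.
by rewrite !fmorphV !rmorph_nat -mulrA.
Qed.

Lemma frame_fstE (f : algC * algC) : f.2 ^+ 2 = A%:R * (D%:R + B%:R * f.1) <->
  f.1 = (map_poly ratr frame_fst_poly).[f.2].
Proof.
have A_neq0 : (A%:R : algC) != 0 by rewrite pnatr_eq0 -lt0n.
have B_neq0 : (B%:R : algC) != 0 by rewrite pnatr_eq0 -lt0n.
rewrite horner_frame_fst; split=> [->|f1E].
  by field; rewrite A_neq0 B_neq0.
by rewrite f1E; field; rewrite A_neq0 B_neq0.
Qed.

Definition quad_poly (q : quad rat) : {poly rat} :=
  let: (a, b, c, d) := q in
  a%:P + b%:P * frame_fst_poly + (c%:P + d%:P * frame_fst_poly) * 'X.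

Lemma horner_quad_poly f q : f.1 = (map_poly ratr frame_fst_poly).[f.2] ->
  (map_poly ratr (quad_poly q)).[f.2] = quad_eval f q.
Proof.
case: q => [[[a b] c] d]; rewrite /quad_poly; move: frame_fst_poly => S f1E.
by rewrite !(rmorphM, rmorphD) /= !map_polyC map_polyX !hornerE -f1E.
Qed.

Lemma nfield_frameP f x : frame A B f -> nfield f.2 x <-> exists q, x = quad_eval f q.
Proof.
move=> f_frame; have [_ /frame_fstE f1E] := f_frame.
split=> [[p ->]|[q ->]]; last by exists (quad_poly q); rewrite horner_quad_poly.
by rewrite -[f.2]quad_eval_snd; apply: horner_quad_eval.
Qed.

Lemma nfield_quad_eval f q : frame A B f -> nfield f.2 (quad_eval f q).
Proof. by move=> f_frame; apply/(nfield_frameP _ f_frame); exists q. Qed.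

End FrameField.

Definition quad_coords (f : algC * algC) (x : algC) : quad rat :=
  epsilon (inhabits (0, 0, 0, 0)) (fun q => x = quad_eval f q).

Definition frame_change (f g : algC * algC) (x : algC) : algC := quad_eval g (quad_coords f x).

Section Galois.

Variables (A B : nat) (f : algC * algC).
Hypotheses (A_gt0 : (0 < A)%N) (B_gt0 : (0 < B)%N) (f_frame : frame A B f).

Local Notation D := (B ^ 2 + 1)%N.
Local Notation K := (nfield f.2).
Local Notation sigma := (frame_change f (frame_conj B f)).

Let nfieldP x : K x <-> exists q, x = quad_eval f q := nfield_frameP A_gt0 B_gt0 x f_frame.
Let K_eval q : K (quad_eval f q) := nfield_quad_eval A_gt0 B_gt0 q f_frame.

Lemma frame_change_eval g q : frame_change f g (quad_eval f q) = quad_eval g q.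
Proof.
rewrite /frame_change; congr quad_eval; apply: (quad_eval_inj A_gt0 B_gt0 f_frame).
symmetry; apply: (epsilon_spec (inhabits (0, 0, 0, 0))
  (fun q' => quad_eval f q = quad_eval f q')).
by exists q.
Qed.

Lemma frame_change_embedding g : frame A B g -> embedding K (frame_change f g).
Proof.
move=> g_frame; split; last split.
- by have := frame_change_eval g (1, 0, 0, 0); rewrite !quad_eval_rat rmorph1.
- move=> _ _ /nfieldP[q ->] /nfieldP[q' ->].
  by rewrite -quad_evalD !frame_change_eval quad_evalD.
- move=> _ _ /nfieldP[q ->] /nfieldP[q' ->].
  by rewrite -(quad_evalM _ _ f_frame) !frame_change_eval (quad_evalM _ _ g_frame).
Qed.

Lemma iter_frame_change i x : K x ->
  iter i sigma x = frame_change f (iter i (frame_conj B) f) x.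
Proof.
move=> /nfieldP[q ->]; rewrite frame_change_eval (quad_eval_iter_conj _ _ f_frame).
elim: i q => // i IHi q.
by rewrite iterSr frame_change_eval (quad_eval_conj _ f_frame) IHi iterSr.
Qed.

Lemma iter_sigma_eval i q :
  iter i sigma (quad_eval f q) = quad_eval (iter i (frame_conj B) f) q.
Proof. by rewrite iter_frame_change ?frame_change_eval //; apply: K_eval. Qed.

Lemma embedding_quad_eval s q :
  embedding K s -> s (quad_eval f q) = quad_eval (s f.1, s f.2) q.
Proof.
move=> s_emb; have K_gen := nfield_gen f.2.
have [_ /(frame_fstE A_gt0 B_gt0) f1E] := f_frame.
have sf1E : s f.1 = (map_poly ratr (frame_fst_poly A B)).[s f.2].
  by rewrite {1}f1E (embedding_horner s_emb).
rewrite -(horner_quad_poly q f1E) (embedding_horner s_emb) //.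
exact: (@horner_quad_poly _ _ (s f.1, s f.2)).
Qed.

Lemma embedding_frame s : embedding K s -> frame A B (s f.1, s f.2).
Proof.
move=> s_emb; have [f1E /(frame_fstE A_gt0 B_gt0) f2E] := f_frame; split; last first.
  apply/(frame_fstE A_gt0 B_gt0); rewrite /= {1}f2E (embedding_horner s_emb) //.
  exact: nfield_gen.
have K_fst : K f.1 by rewrite f2E; apply/nfield_horner/nfield_gen.
have := embedding_horner s_emb 'X^2 K_fst; rewrite map_polyXn !hornerXn /= f1E => <-.
by have := embedding_rat s_emb D%:R; rewrite rmorph_nat.
Qed.

Lemma embedding_iter_sigma s : embedding K s ->
  exists i : 'I_4, forall x, K x -> s x = iter i sigma x.
Proof.
move=> s_emb; have [i sfE] := frame_exhaustive f_frame (embedding_frame s_emb).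
by exists i => _ /nfieldP[q ->]; rewrite (embedding_quad_eval q s_emb) sfE iter_sigma_eval.
Qed.

Lemma iter_sigma_embedding i : embedding K (iter i sigma).
Proof.
have [e1 [eD eM]] := frame_change_embedding (frame_iter_conj i f_frame).
have K1 : K 1 by rewrite -(rmorph1 ratr); apply: nfield_rat.
split; first by rewrite iter_frame_change.
by split=> x y Kx Ky; rewrite !iter_frame_change //;
  [exact: eD | exact: nfieldD | exact: eM | exact: nfieldM].
Qed.

Lemma sigma_automorphism : automorphism K sigma.
Proof.
split; first exact: (iter_sigma_embedding 1).
split=> [_ /nfieldP[q ->]|_ /nfieldP[q ->]].
  rewrite frame_change_eval (quad_eval_conj _ f_frame); exact: K_eval.
exists (quad_eval f (iter 3 (quad_conj B) q)); split; first exact: K_eval.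
by rewrite frame_change_eval (quad_eval_conj _ f_frame) -iterS quad_conj4.
Qed.

Definition frame_conjugates (q : quad rat) : seq algC :=
  [seq quad_eval g q | g <- traject (frame_conj B) f 4].

Lemma frame_conjugates_uniq q : quad_generating q -> uniq (frame_conjugates q).
Proof.
move/(quad_conj_uniq B); rewrite -(map_inj_uniq (quad_eval_inj A_gt0 B_gt0 f_frame)).
congr uniq; apply: (@eq_from_nth _ 0) => [|i]; rewrite !size_map // size_traject => lt_i4.
rewrite /frame_conjugates !(nth_map f) ?(nth_map q) ?size_traject // !nth_traject //.
by rewrite (quad_eval_iter_conj _ _ f_frame).
Qed.

Lemma frame_conjugates_root q (p : {poly rat}) :
  root (map_poly ratr p) (quad_eval f q) -> all (root (map_poly ratr p)) (frame_conjugates q).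
Proof.
move=> /rootP p0; apply/allP => _ /mapP[g /trajectP[i _ ->] ->].
have g_emb := frame_change_embedding (frame_iter_conj i f_frame).
rewrite rootE -frame_change_eval -(embedding_horner g_emb); last exact: K_eval.
by rewrite p0; have := embedding_rat g_emb 0; rewrite rmorph0 => ->.
Qed.

Lemma quad_root_size q (p : {poly rat}) :
  quad_generating q -> p != 0 -> root (map_poly ratr p) (quad_eval f q) -> (4 < size p)%N.
Proof.
move=> q_gen p_neq0 /frame_conjugates_root p_roots.
have := max_poly_roots _ p_roots (frame_conjugates_uniq q_gen).
by rewrite size_map_poly map_poly_eq0 size_map size_traject; apply.
Qed.

Lemma iter_sigma_neq (i j : 'I_4) :
  i <> j -> exists x, K x /\ iter i sigma x <> iter j sigma x.
Proof.
move/eqP => i_neq_j; exists f.2; split; first exact: nfield_gen.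
rewrite -[f.2]quad_eval_snd !iter_sigma_eval.
have nthE (k : 'I_4) : nth 0 (frame_conjugates (0, 0, 1, 0)) k =
    quad_eval (iter k (frame_conj B) f) (0, 0, 1, 0).
  by rewrite (nth_map f) ?size_traject // nth_traject.
rewrite -!nthE; apply/eqP; rewrite nth_uniq ?size_map ?size_traject //.
exact: frame_conjugates_uniq.
Qed.

Lemma frame_totally_real : f.1 \is Num.real -> f.2 \is Num.real -> totally_real K.
Proof.
move=> f1_real f2_real s /embedding_iter_sigma[i sE] x Kx; rewrite sE //.
have rat_real (a : rat) : (ratr a : algC) \is Num.real := Creal_Crat (Crat_rat a).
case/nfieldP: Kx => q ->; rewrite iter_sigma_eval (quad_eval_iter_conj _ _ f_frame).
case: (iter i _ q) => [[[a b] c] d] /=.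
have linear_real (u v : rat) : ratr u + ratr v * f.1 \is Num.real.
  exact: realD (rat_real u) (realM (rat_real v) f1_real).
exact: realD (linear_real a b) (realM (linear_real c d) f2_real).
Qed.

End Galois.

Lemma map_intr_ratr (p : {poly int}) :
  map_poly intr p = map_poly ratr (map_poly intr p : {poly rat}) :> {poly algC}.
Proof. by rewrite -map_poly_comp; apply: eq_map_poly => x /=; rewrite ratr_int. Qed.

Lemma size_map_intr (R : numDomainType) (p : {poly int}) :
  size (map_poly intr p : {poly R}) = size p.
Proof. by apply: size_map_inj_poly => //; apply: intr_inj. Qed.

Lemma map_intr_eq0 (R : numDomainType) (p : {poly int}) :
  ((map_poly intr p : {poly R}) == 0) = (p == 0).
Proof. by rewrite -!size_poly_eq0 size_map_intr. Qed.

Lemma alg_int_Aint x : alg_int x <-> x \in Aint.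
Proof.
split=> [[p [p_monic p_root]]|x_int].
  apply: (root_monic_Aint p_root); first exact: monic_map.
  by apply/polyOverP => i; rewrite coef_map /= rpred_int.
have [p mE] := floorpP x_int; exists p; split; last by rewrite -mE root_minCpoly.
have := minCpoly_monic x; rewrite mE !monicE lead_coef_map_inj //; last exact: intr_inj.
by rewrite -[1](mulr1z 1) eqr_int.
Qed.

Lemma embedding_Aint theta s x :
  embedding (nfield theta) s -> nfield theta x -> x \in Aint -> s x \in Aint.
Proof.
move=> s_emb Kx /alg_int_Aint[p [p_monic /rootP px0]]; apply/alg_int_Aint; exists p.
split=> //; rewrite rootE map_intr_ratr -(embedding_horner s_emb) // -map_intr_ratr px0.
by have := embedding_rat s_emb 0; rewrite rmorph0 => ->.
Qed.

Lemma ratr_Aint (a : rat) : (ratr a : algC) \in Aint -> a \in Num.int.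
Proof. by move=> a_int; rewrite -Cint_rat Cint_rat_Aint ?Crat_rat. Qed.

Lemma sqr_Aint x : x ^+ 2 \in Aint -> x \in Aint.
Proof.
move=> x2_int; apply: (@root_monic_Aint (minCpoly (x ^+ 2) \Po 'X^2)).
- by rewrite root_comp hornerXn root_minCpoly.
- rewrite monicE lead_coef_comp ?size_polyXn // lead_coefXn expr1n mulr1.
  by rewrite -monicE minCpoly_monic.
- by apply: polyOver_comp; rewrite ?polyOverXn.
Qed.

Lemma half_int (a : rat) (m : int) : 2 * a = m%:~R -> (2 %| m)%Z -> a \in Num.int.
Proof.
move=> aE /dvdzP[n mE]; apply/intrP; exists n; apply: (@mulfI _ (2 : rat)) => //.
by rewrite aE mE rmorphM mulrC.
Qed.

Lemma dvd2_norm (M N z j : int) :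
  M * M - (4 * j + 2) * (N * N) = 4 * z -> (2 %| M)%Z /\ (2 %| N)%Z.
Proof.
have [[m ME] [n NE]] : (exists m, M = 2 * m \/ M = 2 * m + 1) /\
    (exists n, N = 2 * n \/ N = 2 * n + 1) by split; [exists (M %/ 2)%Z | exists (N %/ 2)%Z]; lia.
by case: ME NE => -> [] -> normE; split; lia.
Qed.

(* With alpha = a + b s and gamma = c + d s, the two hypotheses say that
   alpha ^ 2 - gamma ^ 2 t ^ 2 is divisible by 4 in Z[s]. *)
Lemma dvd2_rel_norm (A' B' a b c d z1 z2 : int) :
    let A := 2 * A' + 1 in let B := 2 * B' + 1 in let D := B * B + 1 in
    a * a + D * (b * b) - A * D * (c * c + D * (d * d) + 2 * c * d * B) = 4 * z1 ->
    2 * a * b - A * ((c * c + D * (d * d)) * B + 2 * c * d * D) = 4 * z2 ->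
  [/\ (2 %| a)%Z, (2 %| b)%Z, (2 %| c)%Z & (2 %| d)%Z].
Proof.
move=> A B D.
have DE : D = 4 * (B' * B' + B') + 2 by rewrite /D /B; ring.
clearbody D; rewrite /A /B DE => norm1E norm2E {DE}.
set j := B' * B' + B' in norm1E norm2E; clearbody j.
have parity (x : int) : exists y, x = 2 * y \/ x = 2 * y + 1 by exists (x %/ 2)%Z; lia.
have [x [aE|aE]] := parity a; last by exfalso; rewrite aE in norm1E; lia.
rewrite {}aE in norm1E norm2E *.
have [y [cE|cE]] := parity c; last by exfalso; rewrite cE in norm2E; lia.
rewrite {}cE in norm1E norm2E *.
have [w [dE|dE]] := parity d; last by exfalso; rewrite dE in norm2E; lia.
rewrite {}dE in norm1E norm2E *.
have [v [bE|bE]] := parity b; last by exfalso; rewrite bE in norm1E; lia.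
by rewrite bE !dvdz_mulr.
Qed.

Lemma odd_intr (n : nat) : odd n -> exists m : int, n%:R = (2 * m + 1)%:~R :> rat.
Proof.
move=> n_odd; exists (Posz n./2); rewrite -[in LHS](odd_double_half n) n_odd -mul2n.
by rewrite !(rmorphM, rmorphD) /=; ring.
Qed.

Lemma eq_mem_pred (T : Type) (P : {pred T}) x y : x = y -> x \in P -> y \in P.
Proof. by move->. Qed.

Section RingOfIntegers.

Variables (A B : nat) (f : algC * algC).
Hypotheses (A_odd : odd A) (B_odd : odd B) (f_frame : frame A B f).

Local Notation D := (B ^ 2 + 1)%N.
Local Notation K := (nfield f.2).
Local Notation conj := (frame_conj B).

Hypotheses (A_sqf : sqfree A) (D_sqf : sqfree D) (co_AD : coprime A D).

Let A_gt0 : (0 < A)%N. Proof. exact: odd_gt0. Qed.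
Let B_gt0 : (0 < B)%N. Proof. exact: odd_gt0. Qed.

Lemma quad_eval_conj_Aint i q :
  quad_eval f q \in Aint -> quad_eval (iter i conj f) q \in Aint.
Proof.
have s_emb := frame_change_embedding A_gt0 B_gt0 f_frame (frame_iter_conj i f_frame).
move=> y_int; rewrite -(frame_change_eval A_gt0 B_gt0 f_frame).
by apply: (embedding_Aint s_emb) => //; apply: (nfield_quad_eval A_gt0 B_gt0).
Qed.

Lemma sqr_odd_succ_mod4 : exists j : int, (D%:R : rat) = (4 * j + 2)%:~R.
Proof.
have [m BE] := odd_intr B_odd; exists (m * m + m).
by rewrite natrD natrX BE !(rmorphM, rmorphD) /=; ring.
Qed.

Lemma quadratic_Aint (a b : rat) :
  ratr a + ratr b * f.1 \in Aint -> a \in Num.int /\ b \in Num.int.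
Proof.
have -> : ratr a + ratr b * f.1 = quad_eval f (a, b, 0, 0) by rewrite /=; ring.
move=> x_int; have x'_int := quad_eval_conj_Aint 1 x_int; have [f1E _] := f_frame.
have /ratr_Aint/intrP[M ME] : ratr (2 * a) \in Aint.
  by apply: eq_mem_pred (rpredD x_int x'_int); rewrite /=; ring.
have /ratr_Aint/intrP[z zE] : ratr (a ^+ 2 - D%:R * b ^+ 2) \in Aint.
  by apply: eq_mem_pred (rpredM x_int x'_int); rewrite /=; ring: f1E.
have /(sqfree_mul_sqr_int D_sqf)/intrP[N NE] : D%:R * (2 * b) ^+ 2 \in Num.int.
  have -> : D%:R * (2 * b) ^+ 2 = (2 * a) ^+ 2 - 4 * (a ^+ 2 - D%:R * b ^+ 2) by ring.
  by rewrite ME zE rpredB ?rpredX ?rpredM ?rpred_int ?rpred_nat.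
have [j DE] := sqr_odd_succ_mod4.
have [] := @dvd2_norm M N z j.
  apply: (@intr_inj rat); rewrite !(rmorphM, rmorphB, rmorphN, rmorphD) /= -ME -NE -zE.
  by transitivity ((2 * a) ^+ 2 - (4 * j + 2)%:~R * (2 * b) ^+ 2);
    [rewrite !(rmorphM, rmorphD) /= | rewrite -DE]; ring.
by move=> M_even N_even; split; [apply: half_int ME _ | apply: half_int NE _].
Qed.

Lemma frame_Aint : f.1 \in Aint /\ f.2 \in Aint.
Proof.
have [f1E f2E] := f_frame.
have f1_int : f.1 \in Aint by apply: sqr_Aint; rewrite f1E rpred_nat.
by split=> //; apply: sqr_Aint; rewrite f2E rpredM ?rpredD ?rpredM ?rpred_nat.
Qed.

Section Coordinates.

Variables (a b c d : rat).
Hypothesis y_int : quad_eval f (a, b, c, d) \in Aint.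

Let y_conj_int i : quad_eval (iter i conj f) (a, b, c, d) \in Aint :=
  quad_eval_conj_Aint i y_int.

Lemma double_base_coords_int : 2 * a \in Num.int /\ 2 * b \in Num.int.
Proof.
apply: quadratic_Aint; apply: eq_mem_pred (rpredD y_int (y_conj_int 2)).
by have [f1E _] := f_frame; rewrite /=; ring: f1E.
Qed.

(* t ^ 2 = A s (s + B) with s + B a unit of inverse s - B, so the relative trace forms of
   y - y'' yield A s (2 gamma) ^ 2 and A s times the norm of 2 gamma, where gamma = c + d s. *)
Lemma double_rel_coords_int : 2 * c \in Num.int /\ 2 * d \in Num.int.
Proof.
have [f1E f2E] := f_frame; have [s_int t_int] := frame_Aint.
pose diff i := quad_eval (iter i conj f) (a, b, c, d) -
  quad_eval (iter i.+2 conj f) (a, b, c, d).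
have diff_int i : diff i \in Aint by rewrite rpredB ?y_conj_int.
have [_ sum_int] : 2 * A%:R * (2 * c) * (2 * d) * D%:R \in Num.int /\
    A%:R * ((2 * c) ^+ 2 + D%:R * (2 * d) ^+ 2) \in Num.int.
  apply: quadratic_Aint.
  have : diff 0%N ^+ 2 * (f.1 - B%:R) \in Aint by rewrite rpredM ?rpredX ?rpredB ?rpred_nat.
  by apply: eq_mem_pred; rewrite /diff /=; ring: f1E f2E.
have [_ dif_int] : (0 : rat) \in Num.int /\
    A%:R * ((2 * c) ^+ 2 - D%:R * (2 * d) ^+ 2) \in Num.int.
  apply: quadratic_Aint; apply: eq_mem_pred (rpredM (diff_int 0%N) (diff_int 1%N)).
  by rewrite /diff /=; ring: f1E f2E.
have c_int : 2 * c \in Num.int.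
  apply: (@sqfree_mul_sqr_int (2 * A)).
    by apply: sqfreeM (sqfree_prime _) A_sqf; rewrite ?coprime2n.
  by apply: eq_mem_pred (rpredD sum_int dif_int); ring.
split=> //; apply: (@sqfree_mul_sqr_int (A * D)); first exact: sqfreeM.
have Ac2_int : A%:R * (2 * c) ^+ 2 \in Num.int by rewrite rpredM ?rpredX ?rpred_nat.
by apply: eq_mem_pred (rpredB sum_int Ac2_int); ring.
Qed.

Lemma coords_int : [/\ a \in Num.int, b \in Num.int, c \in Num.int & d \in Num.int].
Proof.
have [f1E f2E] := f_frame.
have [/intrP[a2 aE] /intrP[b2 bE]] := double_base_coords_int.
have [/intrP[c2 cE] /intrP[d2 dE]] := double_rel_coords_int.
have [/intrP[z1 z1E] /intrP[z2 z2E]] :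
    a ^+ 2 + D%:R * b ^+ 2 - A%:R * D%:R * (c ^+ 2 + D%:R * d ^+ 2 + 2 * c * d * B%:R)
      \in Num.int /\
    2 * a * b - A%:R * ((c ^+ 2 + D%:R * d ^+ 2) * B%:R + 2 * c * d * D%:R) \in Num.int.
  apply: quadratic_Aint; apply: eq_mem_pred (rpredM y_int (y_conj_int 2)).
  by rewrite /=; ring: f1E f2E.
have [A' AE] := odd_intr A_odd; have [B' BE] := odd_intr B_odd.
have DE : (D%:R : rat) = B%:R * B%:R + 1 by ring.
have [] := @dvd2_rel_norm A' B' a2 b2 c2 d2 z1 z2.
- apply: (@intr_inj rat); rewrite !(rmorphM, rmorphD, rmorphB, rmorphN) /=.
  by rewrite -z1E -aE -bE -cE -dE DE AE BE !(rmorphM, rmorphD) /=; ring.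
- apply: (@intr_inj rat); rewrite !(rmorphM, rmorphD, rmorphB, rmorphN) /=.
  by rewrite -z2E -aE -bE -cE -dE DE AE BE !(rmorphM, rmorphD) /=; ring.
by split;
  [apply: half_int aE _ | apply: half_int bE _ | apply: half_int cE _ | apply: half_int dE _].
Qed.

End Coordinates.

Lemma ring_of_intP y :
  ring_of_int K y <-> exists q : quad int, y = quad_eval f (quad_map intr q).
Proof.
split=> [[/(nfield_frameP A_gt0 B_gt0 _ f_frame) [[[[a b] c] d] ->]]|[q ->]].
  move/alg_int_Aint/coords_int => [/intrP[a' ->] /intrP[b' ->] /intrP[c' ->] /intrP[d' ->]].
  by exists (a', b', c', d').
split; first exact: (nfield_quad_eval A_gt0 B_gt0).
have [s_int t_int] := frame_Aint; case: q => [[[a b] c] d].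
by apply/alg_int_Aint; rewrite /= !ratr_int !(rpredD, rpredM) ?rpred_int.
Qed.

End RingOfIntegers.

Definition quad_coord (R : nmodType) (q : quad R) (i : 'I_4) : R :=
  let: (a, b, c, d) := q in nth 0 [:: a; b; c; d] i.

Definition quad_of (R : Type) (c : 'I_4 -> R) : quad R :=
  (c (inord 0), c (inord 1), c (inord 2), c (inord 3)).

Definition quad_basis (i : 'I_4) : quad rat :=
  nth (0, 0, 0, 0) [:: (1, 0, 0, 0); (0, 1, 0, 0); (0, 0, 1, 0); (0, 0, 0, 1)] i.

Lemma quad_ofK (R : nmodType) (c : 'I_4 -> R) : quad_coord (quad_of c) =1 c.
Proof. by case=> [[|[|[|[|//]]]] lt_i4] /=; congr c; apply: val_inj; rewrite /= inordK. Qed.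

Lemma quad_coordK (R : nmodType) (q : quad R) : quad_of (quad_coord q) = q.
Proof. by case: q => [[[a b] c] d]; rewrite /quad_of /= !inordK. Qed.

Lemma quad_map_inj (R S : Type) (h : R -> S) : injective h -> injective (quad_map h).
Proof.
by move=> h_inj [[[a b] c] d] [[[a' b'] c'] d'] [] /h_inj -> /h_inj -> /h_inj -> /h_inj ->.
Qed.

Lemma quad_eval_sum f (q : quad int) : quad_eval f (quad_map intr q) =
  \sum_i (quad_coord q i)%:~R * quad_eval f (quad_basis i).
Proof.
case: q => [[[a b] c] d]; rewrite !big_ord_recl big_ord0 /quad_basis /= !ratr_int.
by ring.
Qed.

Lemma quad_eval_of f (c : 'I_4 -> int) : quad_eval f (quad_map intr (quad_of c)) =
  \sum_i (c i)%:~R * quad_eval f (quad_basis i).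
Proof. by rewrite quad_eval_sum; apply: eq_bigr => i _; rewrite quad_ofK. Qed.

Section Discriminant.

Variables (A B : nat) (f : algC * algC).
Hypothesis f_frame : frame A B f.

Local Notation D := (B ^ 2 + 1)%N.
Local Notation K := (nfield f.2).
Local Notation conj := (frame_conj B).
Local Notation sigma := (frame_change f (conj f)).

Definition frame_mx : 'M[algC]_4 :=
  \matrix_(i, j) quad_eval (iter j conj f) (quad_basis i).

Lemma det_mx22 (R : comNzRingType) (M : 'M[R]_2) :
  \det M = M 0 0 * M 1 1 - M 0 1 * M 1 0.
Proof.
rewrite (expand_det_row _ 0) !big_ord_recl big_ord0 /cofactor !det_mx11 !mxE /=.
have -> : lift (0 : 'I_2) (0 : 'I_1) = 1 by apply: val_inj.
have -> : lift (1 : 'I_2) (0 : 'I_1) = 0 by apply: val_inj.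
by rewrite /bump /=; ring.
Qed.

(* The trace form is block diagonal for the splitting K = Q(s) + Q(s) t. *)
Lemma det_frame_mx_sqr : \det frame_mx ^+ 2 = (256 * A ^ 2 * D ^ 3)%:R.
Proof.
have [f1E f2E] := f_frame.
rewrite expr2 -{2}det_tr -det_mulmx.
pose mx22 (x y z w : algC) : 'M_2 := \matrix_(i < 2, j < 2)
  (if i == 0 then (if j == 0 then x else y) else (if j == 0 then z else w)).
have -> : frame_mx *m frame_mx^T = block_mx (mx22 4 0 0 (4 * D%:R)) 0 0
  (mx22 (4 * A%:R * D%:R) (4 * A%:R * B%:R * D%:R)
      (4 * A%:R * B%:R * D%:R) (4 * A%:R * D%:R ^+ 2)) :> 'M_(2 + 2).
  apply/matrixP => i j; rewrite !mxE !big_ord_recl big_ord0 !mxE addr0.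
  case: (splitP i) => i' iE; rewrite !mxE; case: (splitP j) => j' jE;
    rewrite !mxE /quad_basis iE jE;
    by case: i' j' {iE jE} => [[|[|//]] ?] [[|[|//]] ?]; rewrite -?val_eqE /=; ring: f1E f2E.
by rewrite (@det_ublock _ 2 2) !det_mx22 !mxE -?val_eqE /=; ring.
Qed.

Lemma frame_mx_unit : (0 < A)%N -> frame_mx \in unitmx.
Proof.
move=> A_gt0; rewrite unitmxE unitfE -sqrf_eq0 det_frame_mx_sqr pnatr_eq0 -lt0n.
by rewrite !(muln_gt0, expn_gt0) A_gt0 addn1.
Qed.

Lemma quad_eval_mul_frame_mx (q : quad int) (j : 'I_4) :
  quad_eval (iter j conj f) (quad_map intr q) =
  ((\row_i (quad_coord q i)%:~R) *m frame_mx) 0 j.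
Proof. by rewrite quad_eval_sum mxE; apply: eq_bigr => i _; rewrite !mxE. Qed.

Lemma frame_abs_disc :
    odd A -> odd B -> sqfree A -> sqfree D -> coprime A D ->
  abs_disc K (256 * A ^ 2 * D ^ 3)%:R.
Proof.
move=> A_odd B_odd A_sqf D_sqf co_AD.
have [A_gt0 B_gt0] : (0 < A)%N /\ (0 < B)%N by rewrite !odd_gt0.
have integersP := ring_of_intP A_odd B_odd f_frame A_sqf D_sqf co_AD.
exists 4%N, (fun i => quad_eval f (quad_basis i)), (fun j => iter j sigma).
split; [|split; [|split; [|split]]].
- move=> i; apply/integersP; exists (quad_of (fun j => (i == j)%:R)).
  rewrite quad_eval_of (bigD1 i) //= eqxx mul1r big1 ?addr0 // => j /negPf j_neq_i.
  by rewrite eq_sym j_neq_i mul0r.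
- move=> y /integersP[q ->]; exists (quad_coord q); split=> [|c]; first exact: quad_eval_sum.
  rewrite -quad_eval_of => /(quad_eval_inj A_gt0 B_gt0 f_frame)/(quad_map_inj (@intr_inj _)) ->.
  by move=> i; rewrite quad_ofK.
- by move=> j; exact: (iter_sigma_embedding A_gt0 B_gt0 f_frame).
- exact: (iter_sigma_neq A_gt0 B_gt0 f_frame).
have <- : frame_mx = \matrix_(i, j) iter j sigma (quad_eval f (quad_basis i)).
  by apply/matrixP => i j; rewrite !mxE (iter_sigma_eval A_gt0 B_gt0 f_frame).
by rewrite det_frame_mx_sqr ger0_norm // ler0n.
Qed.

End Discriminant.

(** * Mahler measures of generators *)

Definition max1norm (z : algC) : algC := if 1 <= `|z| then `|z| else 1.

Definition mahler_roots (l : seq algC) : algC := \prod_(z <- l) max1norm z.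

Lemma mahler_prod_XsubC (c : algC) (l : seq algC) : c != 0 ->
  mahler (c *: \prod_(z <- l) ('X - z%:P)) = `|c| * mahler_roots l.
Proof.
move=> c_neq0; rewrite /mahler /rootsC; case: closed_field_poly_normal => r /= rE.
have lead_c : lead_coef (c *: \prod_(z <- l) ('X - z%:P)) = c.
  by rewrite lead_coefZ lead_coef_prod_XsubC mulr1.
rewrite lead_c in rE *; rewrite big_mkcond; congr (_ * _); apply: perm_big.
by rewrite perm_sym; apply: prod_XsubC_eq; apply: (scalerI c_neq0).
Qed.

Lemma max1norm_ge1 z : 1 <= max1norm z.
Proof. by rewrite /max1norm; case: ifP. Qed.

Lemma max1norm_ge0 z : 0 <= max1norm z.
Proof. exact: le_trans ler01 (max1norm_ge1 z). Qed.

Lemma norm_le_max1norm z : `|z| <= max1norm z.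
Proof.
rewrite /max1norm; case: ifPn => // norm_lt1.
by rewrite ltW // real_ltNge ?normr_real ?real1.
Qed.

Lemma max1norm_le z c : 1 <= c -> `|z| <= c -> max1norm z <= c.
Proof. by rewrite /max1norm; case: ifP. Qed.

Lemma norm_sub_le_max1norm x y : `|x - y| <= 2 * (max1norm x * max1norm y).
Proof.
rewrite (le_trans (ler_normB _ _)) // [2]/(1 + 1) mulrDl mul1r lerD //.
  by rewrite (le_trans (norm_le_max1norm x)) // ler_peMr ?max1norm_ge0 ?max1norm_ge1.
by rewrite (le_trans (norm_le_max1norm y)) // ler_peMl ?max1norm_ge0 ?max1norm_ge1.
Qed.

Lemma mahler_roots_ge1 l : 1 <= mahler_roots l.
Proof.
rewrite /mahler_roots; elim: l => [|z l IHl]; first by rewrite big_nil.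
by rewrite big_cons mulr_ege1 // max1norm_ge1.
Qed.

Lemma mahler_roots_real l : mahler_roots l \is Num.real.
Proof. by apply: ger0_real; apply: le_trans ler01 (mahler_roots_ge1 l). Qed.

Lemma norm_le_mahler_roots z l : z \in l -> `|z| <= mahler_roots l.
Proof.
move=> /perm_to_rem z_l; rewrite /mahler_roots (perm_big _ z_l) big_cons.
apply: le_trans (norm_le_max1norm z) _.
by rewrite ler_peMr ?max1norm_ge0 ?mahler_roots_ge1.
Qed.

Lemma minZpoly_monic_eq alpha (P p : {poly int}) :
  P \is monic -> minZpoly alpha P -> minZpoly alpha p -> p = P.
Proof.
move=> P_monic [P_neq0 [P_root [_ P_min]]] [p_neq0 [p_root [p_contents p_min]]].
have size_eq : size p = size P.
  by apply/eqP; rewrite eqn_leq p_min // P_min.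
have pE : p = lead_coef p *: P.
  apply/eqP; rewrite -subr_eq0; apply: contraT => rem_neq0.
  have /(P_min _ rem_neq0) : root (map_poly intr (p - lead_coef p *: P)) alpha.
    rewrite rmorphB /= linearZ rootE hornerD hornerN hornerZ /= (rootP p_root) (rootP P_root).
    by rewrite mulr0 subr0.
  rewrite leqNgt -[size P]prednK ?size_poly_gt0 // ltnS => /negP[]; apply/leq_sizeP => j.
  rewrite coefB coefZ leq_eqVlt => /predU1P[<-|].
    by rewrite -/(lead_coef P) (monicP P_monic) mulr1 lead_coefE size_eq subrr.
  rewrite prednK ?size_poly_gt0 // => le_size_j.
  by rewrite !nth_default ?size_eq // mulr0 subrr.
have lead1 : lead_coef p = 1.
  by rewrite -p_contents {2}pE zcontentsZ (zcontents_monic P_monic) mulr1.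
by rewrite pE lead1 scale1r.
Qed.

Lemma lattice_discrete n (M : 'M[algC]_n) (h : algC) : M \in unitmx ->
  exists N : nat, forall v : 'rV[int]_n,
    (forall j, `|(map_mx intr v *m M) 0 j| <= h) -> forall i, (`|v 0%R i| < N)%N.
Proof.
move=> M_unit; pose W := \sum_i \sum_j h * `|invmx M j i|.
exists (Num.bound `|W|) => v v_le i; rewrite -(ltr_nat algC) natr_absz intr_norm.
have h_ge0 : 0 <= h by apply: le_trans (v_le i); apply: normr_ge0.
have W_ge0 : 0 <= W by do 2![apply: sumr_ge0 => ? _]; rewrite mulr_ge0.
apply: le_lt_trans (archi_boundP (normr_ge0 W)); rewrite (ger0_norm W_ge0).
have -> : (v 0 i)%:~R = (map_mx intr v *m M *m invmx M) 0 i :> algC by rewrite mulmxK // mxE.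
rewrite mxE (le_trans (ler_norm_sum _ _ _)) // [leRHS](bigD1 i) //=.
rewrite ler_wpDr ?sumr_ge0 // => [k _|].
  by apply: sumr_ge0 => j _; rewrite mulr_ge0.
by apply: ler_sum => j _; rewrite normrM ler_wpM2r.
Qed.

Lemma finite_int_box n N :
  exists s : seq 'rV[int]_n, forall v : 'rV[int]_n, (forall i, (`|v 0%R i| < N)%N) -> v \in s.
Proof.
exists [seq \row_i ((e i : nat)%:Z - N%:Z) | e : {ffun 'I_n -> 'I_(N + N).+1}] => v v_lt.
apply/imageP; exists [ffun i => inord `|v 0 i + N%:Z|] => //.
apply/rowP => i; have := v_lt i; rewrite mxE ffunE; move: (v 0 i) => z z_lt.
by rewrite inordK; lia.
Qed.

Lemma exists_min_of_finite_sublevel (T : choiceType) (R : numDomainType) (S : pred T)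
    (F : T -> R) (x0 : T) (s : seq T) :
    (forall x, F x \is Num.real) -> S x0 ->
    (forall x, F x <= F x0 -> x \in s) ->
  exists2 x, S x & forall y, S y -> F x <= F y.
Proof.
move=> F_real S_x0 sublevel.
pose i0 : seq_sub s := SeqSub (sublevel _ (lexx _)).
case: (@real_arg_minP R _ i0 (S \o val) (F \o val) S_x0) => [i _|i S_i i_min]; first exact: F_real.
exists (val i) => // y S_y.
have [/sublevel y_s|/ltW] := real_leP (F_real y) (F_real x0).
  exact: (i_min (SeqSub y_s)).
exact: le_trans (i_min i0 S_x0).
Qed.

Lemma sqr_sub_sqr_monic_size (R : idomainType) (a k m l u : R) :
  let p := (('X - a%:P) ^+ 2 + k%:P) ^+ 2 - u *: (m *: ('X - a%:P) + l%:P) ^+ 2 in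
  p \is monic /\ size p = 5%N.
Proof.
set e := 'X - a%:P.
have sz_e2 : size (e ^+ 2) = 3%N by rewrite size_exp_XsubC.
have sz_k : (size k%:P < size (e ^+ 2))%N by rewrite sz_e2 (leq_ltn_trans (size_polyC_leq1 _)).
have quadratic_monic : e ^+ 2 + k%:P \is monic.
  by rewrite monicE lead_coefDl // -monicE monic_exp ?monicXsubC.
have sz_quartic : size ((e ^+ 2 + k%:P) ^+ 2) = 5%N.
  by rewrite size_monicM ?monic_neq0 // size_polyDl // sz_e2.
have sz_linear : (size (m *: e + l%:P)%R <= 2)%N.
  rewrite (leq_trans (size_polyD _ _)) // geq_max (leq_trans (size_scale_leq _ _)) ?size_XsubC //.
  by rewrite (leq_trans (size_polyC_leq1 _)).
have sz_rem : (size (- (u *: (m *: e + l%:P) ^+ 2)) < size ((e ^+ 2 + k%:P) ^+ 2)%R)%N.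
  rewrite size_polyN sz_quartic ltnS (leq_trans (size_scale_leq _ _)) //.
  rewrite (leq_trans (size_poly_exp_leq _ _)) // muln2 -addnn.
  by case: size sz_linear => [|[|[|]]].
by rewrite /= monicE lead_coefDl // size_polyDl // -monicE monic_exp.
Qed.

Section FrameMahler.

Variables (A B : nat) (f : algC * algC).
Hypotheses (A_gt0 : (0 < A)%N) (B_gt0 : (0 < B)%N) (f_frame : frame A B f).

Local Notation D := (B ^ 2 + 1)%N.
Local Notation K := (nfield f.2).
Local Notation conj := (frame_conj B).
Local Notation conjugates q := (frame_conjugates B f (quad_map intr q)).

(* With e = X - a the conjugates are the roots of (e - b s) ^ 2 = (c + d s) ^ 2 t ^ 2, that is
   of e ^ 2 + b ^ 2 D - P = (2 b e + Q) s, where (c + d s) ^ 2 t ^ 2 = P + Q s. *)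
Definition quad_charpoly (q : quad int) : {poly int} :=
  let: (a, b, c, d) := q in
  let e := 'X - a%:P in
  let P := A%:R * (D%:R * (c * c + D%:R * d * d) + 2 * c * d * B%:R * D%:R) in
  let Q := A%:R * (B%:R * (c * c + D%:R * d * d) + 2 * c * d * D%:R) in
  (e ^+ 2 + (b * b * D%:R - P)%:P) ^+ 2 - D%:R *: ((2 * b) *: e + Q%:P) ^+ 2.

Lemma quad_charpoly_monic_size q :
  quad_charpoly q \is monic /\ size (quad_charpoly q) = 5%N.
Proof. by case: q => [[[a b] c] d]; apply: sqr_sub_sqr_monic_size. Qed.

Lemma quad_charpoly_root q :
  root (map_poly intr (quad_charpoly q)) (quad_eval f (quad_map intr q)).
Proof.
case: q => [[[a b] c] d]; have [f1E f2E] := f_frame.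
rewrite /quad_charpoly rootE !(rmorphB, rmorphD, rmorphXn) /= !linearZ /= !rmorphXn /=.
rewrite !(rmorphB, rmorphD) /= !linearZ /= !(rmorphB, rmorphD) /= map_polyX !map_polyC.
rewrite !hornerE /= !ratr_int.
by apply/eqP; ring: f1E f2E.
Qed.

Lemma quad_generating_intr (q : quad int) :
  quad_generating (quad_map intr q : quad rat) = quad_generating q.
Proof. by case: q => [[[a b] c] d]; rewrite /= !xpair_eqE !intr_eq0. Qed.

Lemma quad_root_int_size q (p : {poly int}) : quad_generating q -> p != 0 ->
  root (map_poly intr p) (quad_eval f (quad_map intr q)) -> (4 < size p)%N.
Proof.
rewrite -quad_generating_intr map_intr_ratr -(map_intr_eq0 rat) -(size_map_intr rat).
exact: (quad_root_size A_gt0 B_gt0 f_frame).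
Qed.

Lemma quad_nf_degree q : quad_generating q -> nf_degree (quad_eval f (quad_map intr q)) = 4%N.
Proof.
move=> q_gen; have [P_monic P_size] := quad_charpoly_monic_size q.
apply: (@nf_degreeE _ 4 (map_poly intr (quad_charpoly q))).
- by rewrite map_intr_eq0 monic_neq0.
- by rewrite -map_intr_ratr quad_charpoly_root.
- by rewrite size_map_intr.
by move=> p; apply: (quad_root_size A_gt0 B_gt0 f_frame); rewrite quad_generating_intr.
Qed.

Lemma frame_cyclic_quartic : cyclic_quartic f.2.
Proof.
split.
  have := @quad_nf_degree (0, 0, 1, 0) isT.
  by rewrite /quad_map !rmorph0 rmorph1 quad_eval_snd.
exists (frame_change f (conj f)); split; first exact: (sigma_automorphism A_gt0 B_gt0 f_frame).
split; first exact: (iter_sigma_neq A_gt0 B_gt0 f_frame).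
by move=> t [t_emb _]; apply: (embedding_iter_sigma A_gt0 B_gt0 f_frame).
Qed.

Lemma minZpoly_quad q : quad_generating q ->
  minZpoly (quad_eval f (quad_map intr q)) (quad_charpoly q).
Proof.
move=> q_gen; have [P_monic P_size] := quad_charpoly_monic_size q.
split; first exact: monic_neq0.
split; first exact: quad_charpoly_root.
split; first exact: zcontents_monic.
by move=> p p_neq0 p_root; rewrite P_size (quad_root_int_size q_gen p_neq0 p_root).
Qed.

Lemma quad_charpolyE q : quad_generating q ->
  map_poly intr (quad_charpoly q) = \prod_(z <- conjugates q) ('X - z%:P) :> {poly algC}.
Proof.
move=> q_gen; have [P_monic P_size] := quad_charpoly_monic_size q.
rewrite {1}(@all_roots_prod_XsubC _ (map_poly intr (quad_charpoly q)) (conjugates q)).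
- by rewrite lead_coef_map_inj; [rewrite (monicP P_monic) scale1r | apply: intr_inj |].
- by rewrite size_map_intr P_size size_map size_traject.
- have := quad_charpoly_root q; rewrite map_intr_ratr.
  exact: (frame_conjugates_root A_gt0 B_gt0 f_frame).
- rewrite uniq_rootsE (frame_conjugates_uniq A_gt0 B_gt0 f_frame) //.
  by rewrite quad_generating_intr.
Qed.

Definition quad_mahler (q : quad int) : algC := mahler_roots (conjugates q).

Lemma mahler_alg_quad q m : quad_generating q ->
  mahler_alg (quad_eval f (quad_map intr q)) m <-> m = quad_mahler q.
Proof.
move=> q_gen; have q_min := minZpoly_quad q_gen.
have mahlerE : mahler (map_poly intr (quad_charpoly q)) = quad_mahler q.
  rewrite quad_charpolyE // -[\prod_(_ <- _) _]scale1r mahler_prod_XsubC ?oner_eq0 //.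
  by rewrite normr1 mul1r.
split=> [[p [p_min ->]]|->]; last by exists (quad_charpoly q).
rewrite (minZpoly_monic_eq _ q_min p_min) //.
by have [] := quad_charpoly_monic_size q.
Qed.

(* If c = d = 0 then sigma ^ 2 fixes the generator, hence all of K. *)
Lemma quad_generatingP (q : quad int) :
  quad_generating q <-> forall x, nfield (quad_eval f (quad_map intr q)) x <-> K x.
Proof.
have K_q := nfield_quad_eval A_gt0 B_gt0 (quad_map intr q) f_frame.
split=> [q_gen|q_gen].
  apply: nfield_eq_of_degree => //; rewrite quad_nf_degree //.
  by have [] := frame_cyclic_quartic.
apply: contraT => q_base.
have [//|x [/q_gen[p ->] []]] := iter_sigma_neq A_gt0 B_gt0 f_frame
  (i := Ordinal (isT : (2 < 4)%N)) (j := Ordinal (isT : (0 < 4)%N)).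
rewrite (embedding_horner (iter_sigma_embedding A_gt0 B_gt0 f_frame 2)) //=; congr (_.[_]).
rewrite -[LHS]/(iter 2 _ _) (iter_sigma_eval A_gt0 B_gt0 f_frame) (frame_conj2 f_frame).
case: q q_base {q_gen p K_q} => [[[a b] c] d]; rewrite negbK xpair_eqE => /andP[/eqP -> /eqP ->].
by rewrite /=; ring.
Qed.

Lemma quad_mahlerE q : quad_mahler q =
  \prod_(i < 4) max1norm (quad_eval (iter i conj f) (quad_map intr q)).
Proof. by rewrite /quad_mahler /mahler_roots !big_map !big_ord_recl big_ord0 !big_cons big_nil. Qed.

(* The product of the two differences of relatively conjugate conjugates is a nonzero integer
   multiple of 4 A s. *)
Lemma quad_mahler_ge q : quad_generating q -> A%:R * `|f.1| <= quad_mahler q.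
Proof.
move=> q_gen; have [f1E f2E] := f_frame.
pose x i := quad_eval (iter i conj f) (quad_map intr q).
have [z z_neq0 diffE] : exists2 z : int, z != 0 &
    (x 0%N - x 2%N) * (x 1%N - x 3%N) = 4 * z%:~R * (A%:R * f.1).
  rewrite /x; case: q q_gen {x} => [[[a b] c] d] q_gen; exists (c * c - D%:R * d * d).
    apply: contraL q_gen => /eqP normE; rewrite negbK.
    have [] := @rat_norm_eq0 B c%:~R d%:~R B_gt0; last first.
      by move/eqP; rewrite intr_eq0 => /eqP -> /eqP; rewrite intr_eq0 => /eqP ->.
    apply/eqP; rewrite -subr_eq0; apply/eqP.
    by transitivity ((c * c - D%:R * d * d)%:~R : rat); [ring | rewrite normE].
  by rewrite /=; ring: f1E f2E.
have diff_le : `|(x 0%N - x 2%N) * (x 1%N - x 3%N)| <= 4 * quad_mahler q.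
  rewrite quad_mahlerE !big_ord_recl big_ord0 mulr1 normrM.
  apply: le_trans (ler_pM _ _ (norm_sub_le_max1norm _ _) (norm_sub_le_max1norm _ _)) _ => //.
  by rewrite le_eqVlt; apply/orP; left; apply/eqP; rewrite /x /=; ring.
rewrite -(@ler_pM2l _ 4) // (le_trans _ diff_le) // diffE !normrM !normr_nat -mulrA.
rewrite ler_pM2l // ler_peMl ?mulr_ge0 ?normr_ge0 ?ler0n //.
by rewrite -intr_norm ler1z -gtz0_ge1 normr_gt0.
Qed.

Lemma exists_min_quad_mahler : exists2 q : quad int, quad_generating q &
  forall q' : quad int, quad_generating q' -> quad_mahler q <= quad_mahler q'.
Proof.
pose q0 : quad int := (0, 0, 1, 0).
have [N box] := lattice_discrete (quad_mahler q0) (frame_mx_unit f_frame A_gt0).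
have [s s_box] := finite_int_box 4 N.
apply: (@exists_min_of_finite_sublevel _ _ (@quad_generating int) quad_mahler q0
  [seq quad_of (v 0) | v : 'rV[int]_4 <- s]) => //.
  by move=> q; apply: mahler_roots_real.
move=> q q_le; apply/mapP; exists (\row_i quad_coord q i); last first.
  by rewrite -[LHS]quad_coordK /quad_of !mxE.
apply: s_box; apply: box => j; apply: le_trans q_le.
have -> : map_mx intr (\row_i quad_coord q i) = \row_i (quad_coord q i)%:~R :> 'rV[algC]_4.
  by apply/rowP => i; rewrite !mxE.
rewrite -quad_eval_mul_frame_mx; apply: norm_le_mahler_roots.
by apply/mapP; exists (iter j conj f) => //; apply/trajectP; exists j.
Qed.

Lemma mahler_OK_quad q :
    odd A -> odd B -> sqfree A -> sqfree D -> coprime A D ->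
    quad_generating q -> (forall q', quad_generating q' -> quad_mahler q <= quad_mahler q') ->
  mahler_OK K (quad_mahler q).
Proof.
move=> A_odd B_odd A_sqf D_sqf co_AD q_gen q_min.
have integersP := ring_of_intP A_odd B_odd f_frame A_sqf D_sqf co_AD.
split.
  exists (quad_eval f (quad_map intr q)); split; first by apply/integersP; exists q.
  by split; [apply/quad_generatingP | apply/mahler_alg_quad].
move=> beta m /integersP[q' ->] /quad_generatingP q'_gen /(mahler_alg_quad _ q'_gen) ->.
exact: q_min.
Qed.

End FrameMahler.

Definition pos_frame (R : realFieldType) (A B s t : R) : Prop :=
  [/\ 1 <= A /\ 1 <= B, 0 < s, s ^+ 2 = B ^+ 2 + 1, 0 < t &
      t ^+ 2 = A * (B ^+ 2 + 1 + B * s)].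

Lemma pos_frame_fst_bounds (R : realFieldType) (A B s t : R) :
  pos_frame A B s t -> B < s <= B + 1.
Proof.
move=> [[A_ge1 B_ge1] s_gt0 s2 t_gt0 t2]; apply/andP; split.
  by rewrite -(@ltr_pXn2r _ 2) ?nnegrE //; lra.
by rewrite -(@ler_pXn2r _ 2) ?nnegrE //; [rewrite s2; nra | lra | lra].
Qed.

Lemma pos_frame_snd_ge1 (R : realFieldType) (A B s t : R) : pos_frame A B s t -> 1 <= t.
Proof.
move=> [[A_ge1 B_ge1] s_gt0 s2 t_gt0 t2].
by rewrite -(@ler_pXn2r _ 2) ?nnegrE ?(ltW t_gt0) // t2 expr1n mulr_ege1 //; nra.
Qed.

Lemma pos_frame_mul_conj (R : realFieldType) (A B s t : R) :
  pos_frame A B s t -> t * ((s - B) * t) = A * s.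
Proof.
move=> [_ _ s2 _ t2].
by transitivity ((s - B) * t ^+ 2); [ring | rewrite t2; ring: s2].
Qed.

Lemma pos_frame_conj_sqr (R : realFieldType) (A B s t : R) :
  pos_frame A B s t -> ((s - B) * t) ^+ 2 = A * (s * (s - B)).
Proof. by move=> [_ _ s2 _ t2]; rewrite exprMn t2; ring: s2. Qed.

Lemma pos_frame_conj_le (R : realFieldType) (A B s t : R) :
  pos_frame A B s t -> (s - B) * t <= t.
Proof.
move=> st_frame; have /andP[B_lt_s s_le] := pos_frame_fst_bounds st_frame.
by have [_ _ _ t_gt0 _] := st_frame; rewrite ler_piMl ?(ltW t_gt0) //; lra.
Qed.

Lemma pos_frame_conj_ge (R : realFieldType) (A B s t : R) :
  pos_frame A B s t -> 1 <= 2 * ((s - B) * t).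
Proof.
move=> st_frame; have /andP[B_lt_s s_le] := pos_frame_fst_bounds st_frame.
have conj_sqr := pos_frame_conj_sqr st_frame.
have [[A_ge1 B_ge1] s_gt0 s2 t_gt0 t2] := st_frame.
have half_le : 1 / 2 <= s * (s - B).
  rewrite -(ler_pM2r (_ : 0 < s + B)); last by lra.
  have -> : s * (s - B) * (s + B) = s by ring: s2.
  by lra.
have conj_gt0 : 0 < (s - B) * t by rewrite mulr_gt0 // subr_gt0.
rewrite -(@ler_pXn2r _ 2) ?nnegrE //; last by rewrite mulr_ge0 // ltW.
by rewrite exprMn conj_sqr expr1n; nra.
Qed.

(* (t - t') ^ 2 - (2 y s) ^ 2 = 2 s (k s - A), where t' is the conjugate (s - B) t. *)
Lemma pos_frame_sub_conj_approx (R : realFieldType) (A B s t y k C : R) :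
    pos_frame A B s t -> A = 2 * y ^+ 2 + k -> 0 < y -> 0 <= C ->
    `|k * s - A| <= C * y ->
  `|t - (s - B) * t - 2 * y * s| <= C.
Proof.
move=> st_frame AE y_gt0 C_ge0 ks_approx.
have conj_le := pos_frame_conj_le st_frame; have conj_sqr := pos_frame_conj_sqr st_frame.
have conj_mul := pos_frame_mul_conj st_frame; have [_ s_gt0 s2 _ t2] := st_frame.
set t' := (s - B) * t in conj_le conj_sqr conj_mul *.
have ys_gt0 : 0 < y * s by rewrite mulr_gt0.
have sum_ge : 2 * (y * s) <= t - t' + 2 * y * s by lra.
have mulE : (t - t' - 2 * y * s) * (t - t' + 2 * y * s) = 2 * s * (k * s - A).
  transitivity (t ^+ 2 + t' ^+ 2 - 2 * (t * t') - 4 * y ^+ 2 * s ^+ 2); first by ring.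
  by rewrite t2 conj_sqr conj_mul AE; ring: s2.
have sum_gt0 : 0 < t - t' + 2 * y * s by lra.
rewrite -(ler_pM2r sum_gt0) -{1}(gtr0_norm sum_gt0) -normrM mulE normrM.
apply: (@le_trans _ _ (C * (2 * (y * s)))); last exact: ler_wpM2l.
rewrite gtr0_norm ?mulr_gt0 //; have -> : C * (2 * (y * s)) = 2 * s * (C * y) by ring.
by rewrite ler_pM2l ?mulr_gt0.
Qed.

(* The conjugates of x + y s - t are x + y s +- t and x - y s +- t'. *)
Lemma pos_frame_conjugates_bound (R : realFieldType) (A B s t x y C : R) :
    let t' := (s - B) * t in
    pos_frame A B s t -> 0 <= C -> `|t - t' - 2 * y * s| <= C ->
    x <= (t + t') / 2 -> (t + t') / 2 < x + 1 ->
  [/\ `|x + y * s - t| <= C + 1, `|x - y * s - t'| <= C + 1,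
      `|x + y * s + t| <= (C + 3) * t & `|x - y * s + t'| <= (2 * C + 4) * t'].
Proof.
move=> t' st_frame C_ge0; rewrite ler_norml => /andP[diff_ge diff_le] x_le x_gt.
have t_ge1 := pos_frame_snd_ge1 st_frame; have := pos_frame_conj_ge st_frame.
rewrite -/t'; move: t' diff_ge diff_le x_le x_gt => t' diff_ge diff_le x_le x_gt t'_ge.
have near_t : `|x + y * s - t| <= C + 1 by rewrite ler_norml; apply/andP; split; lra.
have near_t' : `|x - y * s - t'| <= C + 1 by rewrite ler_norml; apply/andP; split; lra.
split=> //.
  apply: (@le_trans _ _ (2 * t + (C + 1))); last by nra.
  by move: near_t; rewrite !ler_norml => /andP[lo hi]; apply/andP; split; lra.
apply: (@le_trans _ _ (2 * t' + (C + 1))); last by nra.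
by move: near_t'; rewrite !ler_norml => /andP[lo hi]; apply/andP; split; lra.
Qed.

Lemma exists_real_frame (A B : nat) : (0 < A)%N ->
  exists s t : algR, [/\ 0 < s, 0 < t & frame A B (algRval s, algRval t)].
Proof.
move=> A_gt0; pose s : algR := Num.sqrt (B ^ 2 + 1)%:R.
have s_gt0 : 0 < s by rewrite sqrtr_gt0 ltr0n addn1.
pose u : algR := A%:R * ((B ^ 2 + 1)%:R + B%:R * s).
have u_gt0 : 0 < u by rewrite mulr_gt0 ?ltr0n // ltr_wpDr ?mulr_ge0 ?ltr0n ?addn1 // ltW.
exists s, (Num.sqrt u); split=> //; [by rewrite sqrtr_gt0 | split=> /=].
  transitivity (algRval (s ^+ 2)); first by ring.
  by rewrite sqr_sqrtr ?ler0n //; ring.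
transitivity (algRval (Num.sqrt u ^+ 2)); first by ring.
by rewrite sqr_sqrtr ?ltW // /u; ring.
Qed.

(* |k sqrt (B ^ 2 + 1) - A| <= C y makes x + y s - t, with x = floor ((t + t') / 2), a generator
   two of whose conjugates are bounded. *)
Definition admissible (C A B y k : nat) : Prop :=
  [/\ odd A, odd B, sqfree A, sqfree (B ^ 2 + 1) & coprime A (B ^ 2 + 1)] /\
  [/\ A = (2 * y ^ 2 + k)%N, (0 < y)%N &
      ((A - C * y) ^ 2 <= k ^ 2 * (B ^ 2 + 1) <= (A + C * y) ^ 2)%N].

Lemma sqrt_approx (R : realFieldType) (s : R) (k D A e : nat) :
    0 <= s -> s ^+ 2 = D%:R -> ((A - e) ^ 2 <= k ^ 2 * D <= (A + e) ^ 2)%N ->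
  `|k%:R * s - A%:R| <= e%:R.
Proof.
move=> s_ge0 s2 /andP[lo hi]; have ks_ge0 : 0 <= k%:R * s by rewrite mulr_ge0.
have ks2 : (k%:R * s) ^+ 2 = (k ^ 2 * D)%:R by rewrite exprMn s2 natrM natrX.
rewrite ler_distl; apply/andP; split.
  have [A_le|e_lt] := leqP A e; first by rewrite (le_trans _ ks_ge0) // subr_le0 ler_nat.
  by rewrite -natrB ?(ltnW e_lt) // -(@ler_pXn2r _ 2) ?nnegrE // ks2 -natrX ler_nat.
by rewrite -natrD -(@ler_pXn2r _ 2) ?nnegrE // ks2 -natrX ler_nat.
Qed.

Section AdmissibleField.

Variables (C A B y k : nat) (s t : algR).
Hypotheses (ABk_adm : admissible C A B y k) (s_gt0 : 0 < s) (t_gt0 : 0 < t).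
Local Notation f := (algRval s, algRval t).
Hypothesis f_frame : frame A B f.

Let A_gt0 : (0 < A)%N. Proof. by have [[A_odd _ _ _ _] _] := ABk_adm; apply: odd_gt0. Qed.
Let B_gt0 : (0 < B)%N. Proof. by have [[_ B_odd _ _ _] _] := ABk_adm; apply: odd_gt0. Qed.

Lemma admissible_pos_frame : pos_frame A%:R B%:R s t.
Proof.
have [sE tE] := f_frame; split; rewrite ?ler1n //; apply: (fmorph_inj algRval).
  by rewrite rmorphXn rmorphD rmorphXn /= sE natrD natrX !rmorph_nat.
by rewrite rmorphXn /= tE; ring.
Qed.

Lemma admissible_diff_approx : `|t - (s - B%:R) * t - 2 * y%:R * s| <= C%:R.
Proof.
have st_frame := admissible_pos_frame; have [_ _ s2 _ _] := st_frame.
have [_ [AE y_gt0 window]] := ABk_adm.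
apply: (pos_frame_sub_conj_approx (k := k%:R) st_frame); rewrite ?ltr0n //.
  by rewrite AE natrD natrM natrX.
by rewrite -natrM; apply: sqrt_approx window; rewrite ?ltW // s2 natrD natrX.
Qed.

Lemma exists_small_quad_mahler : exists2 q : quad int, quad_generating q &
  quad_mahler B f q <= ((C + 1) ^ 2 * (C + 3) * (2 * C + 4))%:R * (A%:R * algRval s).
Proof.
have st_frame := admissible_pos_frame; pose t' := (s - B%:R) * t.
pose x := Num.floor ((t + t') / 2).
have [||bound0 bound1 bound2 bound3] :=
    pos_frame_conjugates_bound (x := x%:~R) st_frame (ler0n _ C) admissible_diff_approx.
- exact: floor_le.
- by have := floorD1_gt ((t + t') / 2); rewrite rmorphD /=; apply.
rewrite -/t' in bound1 bound3.
have max1norm_algR (z c : algR) (w : algC) : w = algRval z -> 1 <= c -> `|z| <= c ->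
    max1norm w <= algRval c.
  by move=> -> c_ge1 z_le; apply: max1norm_le.
have CS_ge1 c : 1 <= C%:R + c.+1%:R :> algR by rewrite -natrD ler1n addnS.
have C3t_ge1 : 1 <= (C%:R + 3) * t.
  exact: mulr_ege1 (CS_ge1 2) (pos_frame_snd_ge1 st_frame).
have C4t'_ge1 : 1 <= (2 * C%:R + 4) * t'.
  have -> : (2 * C%:R + 4) * t' = (C%:R + 2) * (2 * t') by ring.
  exact: mulr_ege1 (CS_ge1 1) (pos_frame_conj_ge st_frame).
exists (x, y%:Z, -1, 0) => //; rewrite quad_mahlerE !big_ord_recl big_ord0 mulr1.
have [/= sE _] := f_frame.
have -> : ((C + 1) ^ 2 * (C + 3) * (2 * C + 4))%:R * (A%:R * algRval s) = algRval (C%:R + 1) *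
    (algRval (C%:R + 1) * (algRval ((C%:R + 3) * t) * algRval ((2 * C%:R + 4) * t'))).
  transitivity (algRval ((C%:R + 1) ^+ 2 * (C%:R + 3) * (2 * C%:R + 4) * (t * t'))); last by ring.
  by rewrite (pos_frame_mul_conj st_frame); ring.
do 3?[apply: ler_pM]; rewrite ?mulr_ge0 ?max1norm_ge0 //.
- by apply: max1norm_algR (CS_ge1 0) bound0; rewrite /=; ring.
- by apply: max1norm_algR (CS_ge1 0) bound1; rewrite /t' /=; ring.
- by apply: max1norm_algR C3t_ge1 bound2; rewrite /=; ring: sE.
- by apply: max1norm_algR C4t'_ge1 bound3; rewrite /t' /=; ring: sE.
Qed.

End AdmissibleField.

(** * Reduction to the choice of parameters *)

Definition commensurate (R : numDomainType) (c x y : R) : Prop :=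
  [/\ 0 <= x, 0 <= y, x <= c * y & y <= c * x].

Section Commensurate.

Variable R : numDomainType.
Implicit Types c x y z : R.

Lemma commensurate_sym c x y : commensurate c x y -> commensurate c y x.
Proof. by case. Qed.

Lemma commensurateZ c x : 1 <= c -> 0 <= x -> commensurate c x (c * x).
Proof.
move=> c_ge1 x_ge0; have c_ge0 : 0 <= c by apply: le_trans c_ge1.
by split; rewrite ?mulr_ge0 // mulrA ler_peMl // mulr_ege1.
Qed.

Lemma commensurateM c c' x x' y y' :
  commensurate c x y -> commensurate c' x' y' -> commensurate (c * c') (x * x') (y * y').
Proof.
move=> [x_ge0 y_ge0 xy yx] [x'_ge0 y'_ge0 xy' yx'].
by split; rewrite ?mulr_ge0 // mulrACA ler_pM.
Qed.

Lemma commensurateX n c x y :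
  commensurate c x y -> commensurate (c ^+ n) (x ^+ n) (y ^+ n).
Proof.
move=> xy; elim: n => [|n IHn]; first by rewrite !expr0; split; rewrite ?mul1r.
by rewrite !exprS; apply: commensurateM.
Qed.

Lemma commensurate_trans c c' x y z :
  0 <= c -> 0 <= c' -> commensurate c x y -> commensurate c' y z -> commensurate (c * c') x z.
Proof.
move=> c_ge0 c'_ge0 [x_ge0 y_ge0 xy yx] [_ z_ge0 yz zy]; split=> //.
  by rewrite (le_trans xy) // -mulrA ler_wpM2l.
by rewrite (le_trans zy) // [c * c']mulrC -mulrA ler_wpM2l.
Qed.

Lemma commensurate_nat (C u v : nat) :
  (u <= C * v)%N -> (v <= C * u)%N -> commensurate (C%:R : R) u%:R v%:R.
Proof. by move=> uv vu; split; rewrite ?ler0n // -natrM ler_nat. Qed.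

End Commensurate.

Lemma commensurate_rootC n (c x y : algC) :
  (0 < n)%N -> 1 <= c -> 0 <= y -> commensurate c x (y ^+ n) -> commensurate c (n.-root x) y.
Proof.
move=> n_gt0 c_ge1 y_ge0 [x_ge0 _ xy yx]; have c_ge0 : 0 <= c by apply: le_trans c_ge1.
have root_ge0 : 0 <= n.-root x by rewrite rootC_ge0.
have c_le_cX : c <= c ^+ n by rewrite -{1}(expr1 c) ler_weXn2l.
split=> //; rewrite -(@ler_pXn2r _ n) ?nnegrE ?mulr_ge0 // exprMn rootCK //.
  by rewrite (le_trans xy) // ler_wpM2r // exprn_ge0.
by rewrite (le_trans yx) // ler_wpM2r.
Qed.

Lemma admissible_field C A B y k : admissible C A B y k ->
  exists theta M : algC,
    [/\ totally_real (nfield theta), cyclic_quartic theta,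
        abs_disc (nfield theta) (256 * A ^ 2 * (B ^ 2 + 1) ^ 3)%:R,
        mahler_OK (nfield theta) M &
        commensurate (2 * ((C + 1) ^ 2 * (C + 3) * (2 * C + 4)))%:R (A * B)%:R M].
Proof.
move=> ABk_adm; have [[A_odd B_odd A_sqf D_sqf co_AD] _] := ABk_adm.
have [A_gt0 B_gt0] : (0 < A)%N /\ (0 < B)%N by rewrite !odd_gt0.
have [s [t [s_gt0 t_gt0 f_frame]]] := exists_real_frame B A_gt0.
have [q q_gen q_min] := exists_min_quad_mahler A_gt0 f_frame.
have [q' q'_gen q'_le] := exists_small_quad_mahler ABk_adm s_gt0 t_gt0 f_frame.
set f := (algRval s, algRval t) in f_frame q_min q'_le.
exists f.2, (quad_mahler B f q); split.
- by apply: (frame_totally_real A_gt0 B_gt0 f_frame); apply: algRvalP.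
- exact: (frame_cyclic_quartic A_gt0 B_gt0 f_frame).
- exact: frame_abs_disc.
- exact: (mahler_OK_quad A_gt0 B_gt0 f_frame).
set c := ((C + 1) ^ 2 * (C + 3) * (2 * C + 4))%N in q'_le *.
have c_gt0 : (0 < c)%N by rewrite !(muln_gt0, expn_gt0, addn_gt0) !orbT.
have fst_gt0 : 0 < f.1 by exact: s_gt0.
have fst_ge : B%:R <= f.1.
  rewrite -(@ler_pXn2r _ 2) ?nnegrE ?ler0n ?(ltW fst_gt0) //.
  by have [-> _] := f_frame; rewrite -natrX ler_nat leq_addr.
have fst_le : f.1 <= (2 * B)%:R.
  rewrite -(@ler_pXn2r _ 2) ?nnegrE ?ler0n ?(ltW fst_gt0) //.
  by have [-> _] := f_frame; rewrite -natrX ler_nat expnMn; lia.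
have AB_le : (A * B)%:R <= quad_mahler B f q.
  apply: le_trans (quad_mahler_ge B_gt0 f_frame q_gen).
  by rewrite natrM ler_wpM2l // (gtr0_norm fst_gt0).
have mahler_ge0 : 0 <= quad_mahler B f q by apply: le_trans AB_le; rewrite ler0n.
split=> //.
  by rewrite (le_trans AB_le) // ler_peMl // ler1n muln_gt0.
rewrite (le_trans (q_min _ q'_gen)) // (le_trans q'_le) //.
have -> : (2 * c)%:R * (A * B)%:R = c%:R * (A%:R * (2 * B)%:R) :> algC by ring.
by rewrite !ler_wpM2l.
Qed.

Lemma root_disc_commensurate (C A B T m n p q : nat) :
    (0 < q)%N -> (0 < C)%N -> (0 < B)%N -> (2 * n + 6 * m = 4 * q)%N ->
    commensurate (C%:R : algC) (T ^ m)%:R B%:R -> commensurate (C%:R : algC) (T ^ n)%:R A%:R ->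
  commensurate ((2048 * C ^ 8)%:R ^+ p) (q.-root (256 * A ^ 2 * (B ^ 2 + 1) ^ 3)%:R ^+ p)
    ((T ^ (4 * p))%:R : algC).
Proof.
move=> q_gt0 C_gt0 B_gt0 mnE TB TA.
have power_part : commensurate (C%:R ^+ 8 : algC) (A%:R ^+ 2 * B%:R ^+ 6) ((T ^ 4)%:R ^+ q).
  have -> : (T ^ 4)%:R ^+ q = (T ^ n)%:R ^+ 2 * (T ^ m)%:R ^+ 6 :> algC.
    by rewrite -!natrX -natrM -!expnM -expnD -mnE [(n * 2)%N]mulnC [(m * 6)%N]mulnC.
  rewrite (exprD C%:R 2 6); apply: commensurate_sym.
  exact: commensurateM (commensurateX 2 TA) (commensurateX 6 TB).
have BD : commensurate (2 : algC) (B ^ 2 + 1)%:R (B%:R ^+ 2).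
  by rewrite -natrX; apply: commensurate_nat; have := leq_mul B_gt0 B_gt0; rewrite ?mulnn; lia.
have disc_part : commensurate (2 ^+ 3 * 256 : algC)
    (256 * A ^ 2 * (B ^ 2 + 1) ^ 3)%:R (A%:R ^+ 2 * B%:R ^+ 6).
  have -> : (256 * A ^ 2 * (B ^ 2 + 1) ^ 3)%:R =
      256 * (A%:R ^+ 2 * (B ^ 2 + 1)%:R ^+ 3) :> algC by ring.
  rewrite [2 ^+ 3 * _]mulrC.
  apply: (@commensurate_trans _ _ _ _ (A%:R ^+ 2 * (B ^ 2 + 1)%:R ^+ 3)) => //.
  - by rewrite exprn_ge0.
  - by apply: commensurate_sym; apply: commensurateZ; rewrite ?mulr_ge0 ?exprn_ge0 ?ler0n // ler1n.
  - rewrite -[2 ^+ 3]mul1r (exprM B%:R 2 3); apply: commensurateM (commensurateX 3 BD).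
    by split; rewrite ?mul1r ?exprn_ge0.
have -> : (T ^ (4 * p))%:R = (T ^ 4)%:R ^+ p :> algC by rewrite -natrX -expnM.
apply: commensurateX; apply: commensurate_rootC => //.
  by rewrite ler1n muln_gt0 expn_gt0 C_gt0.
have -> : (2048 * C ^ 8)%:R = 2 ^+ 3 * 256 * C%:R ^+ 8 :> algC by ring.
by apply: commensurate_trans disc_part power_part; rewrite ?mulr_ge0 ?exprn_ge0.
Qed.

Definition abundant_parameters (m n : nat) : Prop :=
  exists2 C : nat, (0 < C)%N & forall T0 : nat, exists T A B y k : nat,
    [/\ (T0 <= T)%N, admissible C A B y k,
        commensurate (C%:R : algC) (T ^ m)%:R B%:R & commensurate (C%:R : algC) (T ^ n)%:R A%:R].

Definition balanced_field (c : nat) (r : rat) (theta M : algC) : Prop :=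
  [/\ totally_real (nfield theta), cyclic_quartic theta, mahler_OK (nfield theta) M &
      exists2 D, abs_disc (nfield theta) D & commensurate c%:R (rpow D r) M].

Lemma exists_large_balanced_field (r : rat) (p := `|numq r|%N) (q := `|denq r|%N) :
    (q <= 4 * p)%N -> (2 * p < q)%N -> abundant_parameters (q - 2 * p) (6 * p - q) ->
  exists2 c : nat, (0 < c)%N &
    forall N : nat, exists theta M, balanced_field c r theta M /\ N%:R < M.
Proof.
move=> q_le p_lt [C C_gt0 params]; have q_gt0 : (0 < q)%N by lia.
pose cM := (C ^ 2 * (2 * ((C + 1) ^ 2 * (C + 3) * (2 * C + 4))))%N.
pose cD := ((2048 * C ^ 8) ^ p)%N.
have [cM_gt0 cD_gt0] : (0 < cM)%N /\ (0 < cD)%N.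
  by rewrite !(muln_gt0, expn_gt0, addn_gt0) C_gt0 orbT.
exists (cD * cM)%N => [|N]; first by rewrite muln_gt0 cD_gt0.
have [T [A [B [y [k [T_ge adm TB TA]]]]]] := params (cM * N.+1)%N.
have B_gt0 : (0 < B)%N by have [[_ B_odd _ _ _] _] := adm; apply: odd_gt0.
have T_gt0 : (0 < T)%N by apply: leq_trans T_ge; rewrite muln_gt0 cM_gt0.
have [theta [M [theta_real theta_cyclic theta_disc M_min AB_M]]] := admissible_field adm.
have TM : commensurate cM%:R (T ^ (4 * p))%:R M.
  rewrite natrM; apply: commensurate_trans AB_M; rewrite ?ler0n //.
  have -> : (4 * p = (6 * p - q) + (q - 2 * p))%N by lia.
  by rewrite expnD -mulnn !natrM; apply: commensurateM.
exists theta, M; split; last first.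
  have [_ _ T_le_M _] := TM; rewrite -(@ltr_pM2l _ cM%:R) ?ltr0n //.
  apply: lt_le_trans T_le_M; rewrite -natrM ltr_nat; apply: leq_trans (leq_trans _ T_ge) _.
    by rewrite ltn_pmul2l.
  by rewrite -{1}(expn1 T) leq_pexp2l //; lia.
split=> //; exists (256 * A ^ 2 * (B ^ 2 + 1) ^ 3)%:R => //; rewrite /rpow -/p -/q natrM.
apply: commensurate_trans TM; rewrite ?ler0n // /cD natrX.
by apply: root_disc_commensurate TB TA => //; lia.
Qed.

Lemma mahler_OK_unique (K K' : algC -> Prop) M M' :
  (forall x, K x <-> K' x) -> mahler_OK K M -> mahler_OK K' M' -> M = M'.
Proof.
move=> KK' [[a [a_int [a_gen a_M]]] M_min] [[a' [a'_int [a'_gen a'_M']]] M'_min].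
apply/le_anti/andP; split.
  apply: (M_min a') => //; first by case: a'_int => /KK' ? ?.
  by move=> x; rewrite a'_gen KK'.
apply: (M'_min a) => //; first by case: a_int => /KK' ? ?.
by move=> x; rewrite a_gen -KK'.
Qed.

Lemma exists_increasing_sequence (T : Type) (P : T -> Prop) (F : T -> algC) :
    (forall x, P x -> 0 <= F x) -> (forall N : nat, exists x, P x /\ N%:R < F x) ->
  exists u : nat -> T, (forall i, P (u i)) /\ {homo F \o u : i j / (i < j)%N >-> i < j}.
Proof.
move=> F_ge0 F_unbounded.
have pick N := constructive_indefinite_description _ (F_unbounded N).
pose u i := iter i (fun x => sval (pick (Num.bound (F x)))) (sval (pick 0%N)).
have u_P i : P (u i) by case: i => [|i]; apply: (svalP (pick _)).1.
exists u; split=> //; apply: homo_ltn => [y x z|i]; first exact: lt_trans.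
exact: lt_trans (archi_boundP (F_ge0 _ (u_P i))) (svalP (pick _)).2.
Qed.

Lemma balanced_fields_of_abundant (r : rat) (p := `|numq r|%N) (q := `|denq r|%N) :
    (q <= 4 * p)%N -> (2 * p < q)%N -> abundant_parameters (q - 2 * p) (6 * p - q) ->
  exists2 c : nat, (0 < c)%N & exists theta M : nat -> algC,
    (forall i, balanced_field c r (theta i) (M i)) /\ {homo M : i j / (i < j)%N >-> i < j}.
Proof.
move=> q_le p_lt params.
have [c c_gt0 unbounded] := exists_large_balanced_field q_le p_lt params.
exists c => //.
have [x [_ _ _ [D _ [_ ? _ _]]]|N|u [u_P u_incr]] :=
  @exists_increasing_sequence _ (fun x => balanced_field c r x.1 x.2) snd.
- by [].
- by have [theta [M [field_M M_gt]]] := unbounded N; exists (theta, M).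
by exists (fst \o u), (snd \o u).
Qed.

Lemma exponents_of_rat (r : rat) (p := `|numq r|%N) (q := `|denq r|%N) :
  1 / 4 <= r -> r < 1 / 2 -> (q <= 4 * p)%N /\ (2 * p < q)%N.
Proof.
move=> r_ge r_lt.
have rE : r * q%:R = p%:R.
  rewrite /p /q !natr_absz !ger0_norm ?denq_ge0 ?numq_ge0 //; last by lra.
  by rewrite -{1}(divq_num_den r) divfK // intr_eq0 denq_neq0.
have q_gt0 : 0 < q%:R :> rat by rewrite ltr0n absz_gt0 denq_neq0.
split; first by rewrite -(ler_nat rat) natrM -rE; nra.
by rewrite -(ltr_nat rat) natrM -rE; nra.
Qed.

(** * Counting and sieving *)

Lemma sum_bool_le_inj (I : finType) (P : pred I) m (g : I -> nat) :
  (forall x, P x -> (g x < m)%N) -> {in P &, injective g} -> (\sum_x P x <= m)%N.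
Proof.
move=> g_lt g_inj.
have -> : (\sum_x P x = size [seq g x | x in P])%N.
  rewrite size_map -cardE -sum1_card [RHS]big_mkcond.
  by apply: eq_bigr => x _; rewrite unfold_in; case: (P x).
rewrite -(size_iota 0 m); apply: uniq_leq_size => [|_ /imageP[x Px ->]].
  by apply/dinjectiveP.
by rewrite mem_iota g_lt.
Qed.

Lemma sum_bool_le_close n L (P : pred nat) : (0 < L)%N ->
    (forall x y, (x < y)%N -> (y < n)%N -> P x -> P y -> (y < x + L)%N) ->
  (\sum_(x < n) P x <= L)%N.
Proof.
move=> L_gt0 close.
apply: (@sum_bool_le_inj _ (fun x : 'I_n => P x) L (fun x => x %% L)%N) => [x _|].
  by rewrite ltn_pmod.
have mod_eq (x y : 'I_n) : P x -> P y -> (x < y)%N -> y == x %[mod L] -> False.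
  move=> Px Py xy; rewrite eqn_mod_dvd ?(ltnW xy) // => /dvdn_leq.
  by rewrite subn_gt0 xy leq_subRL ?(ltnW xy) // leqNgt close // => /(_ isT).
move=> x y Px Py /eqP xyE; apply: val_inj => /=; have [xy|yx|//] := ltngtP x y.
  by case: (mod_eq x y); rewrite // eq_sym.
by case: (mod_eq y x).
Qed.

Lemma sum_bool_le1 n1 n2 (P : nat -> nat -> bool) :
    (forall x x' i i', (x < n1)%N -> (x' < n1)%N -> (i < n2)%N -> (i' < n2)%N ->
       P x i -> P x' i' -> x = x' /\ i = i') ->
  (\sum_(x < n1) \sum_(i < n2) P x i <= 1)%N.
Proof.
move=> P_uniq; rewrite pair_big /=.
apply: (@sum_bool_le_inj _ (fun u : 'I_n1 * 'I_n2 => P u.1 u.2) 1 (fun=> 0%N)) => // u v Pu Pv _.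
have [] := P_uniq u.1 v.1 u.2 v.2 (ltn_ord _) (ltn_ord _) (ltn_ord _) (ltn_ord _) Pu Pv.
by case: u v {Pu Pv} => [x i] [x' i'] /= /val_inj -> /val_inj ->.
Qed.

Lemma eqn_mod_mul2l m u x y :
  coprime m u -> (u * x == u * y %[mod m]) = (x == y %[mod m]).
Proof.
move=> co_mu; wlog le_yx : x y / (y <= x)%N => [sym|].
  have [/sym //|/ltnW/sym] := leqP y x.
  by rewrite eq_sym => ->; rewrite eq_sym.
by rewrite !eqn_mod_dvd ?leq_mul2l ?le_yx ?orbT // -mulnBr Gauss_dvdr.
Qed.

Lemma count_linear_congr n m u v c : (0 < m)%N -> coprime m u ->
  (\sum_(x < n) (u * x + v == c %[mod m]) <= n %/ m + 1)%N.
Proof.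
move=> m_gt0 co_mu.
apply: (@sum_bool_le_inj _ (fun x : 'I_n => u * x + v == c %[mod m])%N _
  (fun x => x %/ m)%N) => [x _|].
  by rewrite addn1 ltnS leq_div2r // ltnW.
move=> x y /eqP xE /eqP yE divE; apply: val_inj => /=.
have /eqP modE : (x == y %[mod m])%N.
  by rewrite -(eqn_mod_mul2l _ _ co_mu) -(eqn_modDr v) xE yE.
by rewrite (divn_eq x m) (divn_eq y m) divE modE.
Qed.

Lemma count_linear p e u v n : prime p -> ~~ (p %| u)%N ->
  (\sum_(x < n) (p ^ e %| u * x + v) <= n %/ p ^ e + 1)%N.
Proof.
move=> p_pr p_u.
have := @count_linear_congr n (p ^ e) u v 0; rewrite expn_gt0 prime_gt0 // mod0n.
by apply; rewrite // coprimeXl // prime_coprime.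
Qed.

Lemma quadratic_congr_roots p e a k U V : prime p -> odd p -> (0 < e)%N ->
    ~~ (p %| a)%N -> ~~ (p %| k)%N ->
    (p ^ e %| a * U ^ 2 + k)%N -> (p ^ e %| a * V ^ 2 + k)%N ->
  (p ^ e %| U + V)%N || (U == V %[mod p ^ e]).
Proof.
move=> p_pr p_odd e_gt0 p_a p_k; wlog le_VU : U V / (V <= U)%N => [sym U_root V_root|].
  have [le_VU|/ltnW le_UV] := leqP V U; first exact: sym.
  by rewrite addnC [U == _ %[mod _]]eq_sym; apply: sym.
move=> U_root V_root; rewrite eqn_mod_dvd //.
have co_pa : coprime (p ^ e) a by rewrite coprimeXl // prime_coprime.
have dvd_mul : (p ^ e %| (U + V) * (U - V))%N.
  by rewrite mulnC -subn_sqr -(Gauss_dvdr _ co_pa) mulnBr -(subnDr k) dvdn_sub.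
have [p_sum|p_sum] := boolP (p %| U + V)%N; last first.
  by move: dvd_mul; rewrite Gauss_dvdr ?coprimeXl ?prime_coprime // => ->; rewrite orbT.
have p_dif : ~~ (p %| U - V)%N.
  apply: contra p_k => p_dif.
  have : (p %| 2 * U)%N.
    have -> : (2 * U = U + V + (U - V))%N by rewrite -addnA subnKC // addnn mul2n.
    exact: dvdn_add.
  rewrite Euclid_dvdM // dvdn_prime2 //; case: eqP => [p2|_ /= p_U].
    by rewrite p2 in p_odd.
  have : (p %| a * U ^ 2 + k)%N by apply: dvdn_trans U_root; rewrite dvdn_exp.
  by rewrite dvdn_addr // dvdn_mull // dvdn_exp.
by move: dvd_mul; rewrite Gauss_dvdl ?coprimeXl ?prime_coprime // => ->.
Qed.

Definition quadratic (a u v k x : nat) : nat := (a * (u * x + v) ^ 2 + k)%N.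

Lemma count_quadratic p e a u v k n : prime p -> odd p ->
    ~~ (p %| a)%N -> ~~ (p %| u)%N -> ~~ (p %| k)%N -> (0 < e)%N ->
  (\sum_(x < n) (p ^ e %| quadratic a u v k x) <= 2 * (n %/ p ^ e + 1))%N.
Proof.
move=> p_pr p_odd p_a p_u p_k e_gt0.
have pe_gt0 : (0 < p ^ e)%N by rewrite expn_gt0 prime_gt0.
have co_pu : coprime (p ^ e) u by rewrite coprimeXl // prime_coprime.
have [/existsP[c c_root]|] := boolP [exists x : 'I_n, (p ^ e %| quadratic a u v k x)%N]; last first.
  by rewrite negb_exists => /forallP no_root; rewrite big1 // => x _; rewrite (negPf (no_root x)).
pose V := (u * c + v)%N.
apply: (@leq_trans (\sum_(x < n) ((p ^ e %| u * x + (v + V)) + (u * x + v == V %[mod p ^ e])))).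
  apply: leq_sum => x _; have [x_root|//] := boolP (p ^ e %| quadratic a u v k x)%N.
  have := quadratic_congr_roots p_pr p_odd e_gt0 p_a p_k x_root c_root.
  by rewrite -/V -addnA => /orP[] ->; rewrite ?leq_addr ?leq_addl.
rewrite big_split mul2n -addnn /= leq_add ?count_linear //.
exact: count_linear_congr.
Qed.

Lemma inv_sqr_prime_le p : prime p -> (2 < p)%N ->
  (p%:R ^+ 2)^-1 <= (4 * p./2%:R)^-1 - (4 * p.+1./2%:R)^-1 :> rat.
Proof.
move=> p_pr p_gt2; have p_odd : odd p by have [p2|//] := even_prime p_pr; rewrite p2 in p_gt2.
have half_gt0 : (0 < p./2)%N by lia.
have -> : p%:R = 2 * p./2%:R + 1 :> rat.
  by rewrite -{1}(odd_double_half p) p_odd -mul2n natrD natrM addrC.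
have -> : p.+1./2 = (p./2 + 1)%N by lia.
move: p./2 half_gt0 => j; rewrite -(ltr0n rat) natrD => j_gt0.
have -> : (4 * j%:R)^-1 - (4 * (j%:R + 1))^-1 = (4 * j%:R * (j%:R + 1))^-1 :> rat.
  by field; rewrite !gt_eqF ?addr_gt0.
by rewrite lef_pV2 ?posrE ?exprn_gt0 ?mulr_gt0 ?addr_gt0 //; lra.
Qed.

Lemma sum_inv_sqr_primes Z N : (2 <= Z)%N ->
  \sum_(Z.+1 <= p < N | prime p) (p%:R ^+ 2)^-1 <= (2 * Z%:R)^-1 :> rat.
Proof.
move=> Z_ge2; have inv_ge0 (m : nat) : 0 <= (4 * m%:R)^-1 :> rat by rewrite invr_ge0 mulr_ge0.
have [N_le|N_gt] := leqP N Z.+1; first by rewrite big_geq // invr_ge0 mulr_ge0.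
pose phi (p : nat) : rat := - (4 * p./2%:R)^-1.
apply: (@le_trans _ _ (\sum_(Z.+1 <= p < N) (phi p.+1 - phi p))).
  rewrite big_mkcond !big_nat; apply: ler_sum => p /andP[Z_lt_p _]; rewrite opprK addrC.
  case: ifP => [p_pr|_]; first by apply: inv_sqr_prime_le; lia.
  by rewrite subr_ge0 lef_pV2 ?posrE ?mulr_gt0 ?ltr0n ?ler_pM2l ?ler_nat //; lia.
rewrite telescope_sumr ?(ltnW N_gt) // opprK addrC.
apply: (@le_trans _ _ (4 * Z.+1./2%:R)^-1); first by rewrite gerBl inv_ge0.
rewrite lef_pV2 ?posrE ?mulr_gt0 ?ltr0n //; [|lia|lia].
by rewrite -(natrM _ 4) -(natrM _ 2) ler_nat; lia.
Qed.

Lemma sum_inv_primes_le_log Z J N : (0 < Z)%N -> (N <= 2 ^ J)%N ->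
  \sum_(Z <= q < N | prime q) q%:R^-1 <= J%:R :> rat.
Proof.
move=> Z_gt0 N_le.
apply: (@le_trans _ _ (\sum_(1 <= q < 2 ^ J) q%:R^-1)).
  rewrite (big_nat_widen _ _ _ _ _ N_le) (big_nat_widenl _ _ _ _ _ Z_gt0) big_mkcond /=.
  by apply: ler_sum => q _; case: ifP; rewrite // invr_ge0.
elim: J {N_le} => [|J IHJ]; first by rewrite big_geq.
have pow_gt0 : (0 < 2 ^ J)%N by rewrite expn_gt0.
rewrite (@big_cat_nat _ _ _ (2 ^ J)) //=; last by rewrite leq_exp2l.
rewrite -natr1; apply: lerD; first exact: IHJ.
apply: (@le_trans _ _ (\sum_(2 ^ J <= i < 2 ^ J.+1) ((2 ^ J)%N%:R^-1 : rat))).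
  rewrite !big_nat; apply: ler_sum => i /andP[i_ge _].
  by rewrite lef_pV2 ?posrE ?ltr0n ?ler_nat // (leq_trans pow_gt0).
rewrite sumr_const_nat expnS mul2n -addnn addnK -[_ *+ _]mulr_natl mulfV //.
by rewrite pnatr_eq0 -lt0n.
Qed.

Lemma prod_primes_dvd (s : seq nat) m : uniq s -> all prime s -> all (dvdn^~ m) s ->
  (\prod_(p <- s) p %| m)%N.
Proof.
elim: s => [|p s IHs]; first by rewrite big_nil dvd1n.
rewrite big_cons /= => /andP[p_s s_uniq] /andP[p_pr s_pr] /andP[p_m s_m].
rewrite Gauss_dvd; first by rewrite p_m IHs.
rewrite prime_coprime // Euclid_dvd_prod // big_has; apply/hasPn => q q_s.
rewrite dvdn_prime2 //; last exact: (allP s_pr).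
by apply: contraNneq p_s => ->.
Qed.

Lemma prod_ge_exp (s : seq nat) c : all (leq c) s -> (c ^ size s <= \prod_(p <- s) p)%N.
Proof.
elim: s => [|p s IHs] /=; first by rewrite big_nil.
by move=> /andP[c_le_p c_le_s]; rewrite big_cons expnS leq_mul // IHs.
Qed.

Lemma sum_prime_divisors J Z N a : (0 < a < 2 ^ J)%N ->
  (\sum_(Z <= q < N | prime q) (q %| a) <= J)%N.
Proof.
move=> /andP[a_gt0 a_lt].
pose s := [seq q <- index_iota Z N | prime q && (q %| a)%N].
have -> : (\sum_(Z <= q < N | prime q) (q %| a) = size s)%N.
  by rewrite size_filter -sum1_count [RHS]big_mkcondr.
have s_pr : all prime s by apply/allP => q; rewrite mem_filter => /andP[/andP[]].
have prod_dvd : (\prod_(p <- s) p %| a)%N.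
  apply: prod_primes_dvd => //; first by rewrite filter_uniq // iota_uniq.
  by apply/allP => q; rewrite mem_filter => /andP[/andP[]].
have prod_ge : (2 ^ size s <= \prod_(p <- s) p)%N.
  by apply: prod_ge_exp; apply/allP => q /(allP s_pr)/prime_gt1.
rewrite -ltnS -(@ltn_exp2l 2) // (leq_ltn_trans (leq_trans prod_ge (dvdn_leq a_gt0 prod_dvd))) //.
by rewrite (ltn_trans a_lt) // ltn_exp2l.
Qed.

Definition primepi (N : nat) : nat := \sum_(0 <= p < N | prime p) 1.

Lemma primepi_le_self N : (primepi N <= N)%N.
Proof.
rewrite /primepi big_mkcond -[leqRHS]muln1 -[X in (_ <= X * _)%N]subn0 -sum_nat_const_nat.
by apply: leq_sum => p _; case: ifP.
Qed.

Lemma leq_primepi M N : (M <= N)%N -> (primepi M <= primepi N)%N.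
Proof. by move=> M_le_N; rewrite /primepi [leqRHS](@big_cat_nat _ _ _ M) //= leq_addr. Qed.

Lemma central_bin_le n : ('C(2 * n, n) <= 2 ^ (2 * n))%N.
Proof.
have lt_n : (n < (2 * n).+1)%N by lia.
rewrite -[X in (_ <= X ^ _)%N]/(1 + 1)%N expnDn (bigD1 (Ordinal lt_n)) //= !exp1n !muln1.
exact: leq_addr.
Qed.

Lemma prime_dvd_central_bin n q : prime q -> (n < q)%N -> (q <= 2 * n)%N -> (q %| 'C(2 * n, n))%N.
Proof.
move=> q_pr n_lt q_le; have n_le : (n <= 2 * n)%N by lia.
have q_nfact : ~~ (q %| n`!)%N.
  rewrite fact_prod Euclid_dvd_prod // big_has; apply/hasPn => i.
  by rewrite mem_index_iota => /andP[i_gt0 i_le]; rewrite gtnNdvd //; lia.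
have : (q %| (2 * n)`!)%N by rewrite dvdn_fact // prime_gt0.
by rewrite -(bin_fact n_le) [(2 * n - n)%N](_ : _ = n) ?Euclid_dvdM ?(negPf q_nfact) ?orbF //; lia.
Qed.

Lemma central_bin_primes n : (0 < n)%N ->
  (n ^ (\sum_(n.+1 <= p < 2 * n | prime p) 1) <= 2 ^ (2 * n))%N.
Proof.
move=> n_gt0; pose s := [seq q <- index_iota n.+1 (2 * n) | prime q].
have -> : (\sum_(n.+1 <= p < 2 * n | prime p) 1 = size s)%N by rewrite size_filter -sum1_count.
have s_mem q : q \in s -> [/\ prime q, (n < q)%N & (q < 2 * n)%N].
  by rewrite mem_filter mem_index_iota => /and3P[].
apply: leq_trans (central_bin_le n); apply: (@leq_trans (\prod_(p <- s) p)).
  by apply: prod_ge_exp; apply/allP => q /s_mem[_ /ltnW].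
apply: dvdn_leq; first by rewrite bin_gt0; lia.
apply: prod_primes_dvd; first by rewrite filter_uniq // iota_uniq.
  by apply/allP => q /s_mem[].
by apply/allP => q /s_mem[q_pr n_lt /ltnW q_le]; apply: prime_dvd_central_bin.
Qed.

Lemma primepi_pow2 J : (3 <= J)%N -> (J * primepi (2 ^ J) <= 4 * 2 ^ J)%N.
Proof.
elim: J => // J IHJ; rewrite ltnS leq_eqVlt => /predU1P[<-|J_ge3].
  by rewrite /primepi unlock.
pose c := (\sum_((2 ^ J).+1 <= p < 2 * 2 ^ J | prime p) 1)%N.
have c_le : (J * c <= 2 * 2 ^ J)%N.
  have := @central_bin_primes (2 ^ J); rewrite expn_gt0 => /(_ isT).
  by rewrite -expnM leq_exp2l.
have pow_nprime : prime (2 ^ J) = false.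
  apply/negP => pow_pr; have : (2 %| 2 ^ J)%N by rewrite dvdn_exp //; lia.
  rewrite dvdn_prime2 // => /eqP powE.
  by have := ltn_exp2l 1 J (isT : 1 < 2)%N; rewrite expn1 -powE ltnn; lia.
have pi_step : primepi (2 ^ J.+1) = (primepi (2 ^ J) + c)%N.
  rewrite /primepi expnS (@big_cat_nat _ _ _ (2 ^ J)) //=; last by rewrite mul2n -addnn leq_addr.
  congr addn; rewrite big_ltn_cond ?pow_nprime //.
  by rewrite mul2n -addnn -[X in (X < _)%N]addn0 ltn_add2l expn_gt0.
by have := IHJ J_ge3; rewrite pi_step expnS; nia.
Qed.

Lemma primepi_density e : (0 < e)%N ->
  exists N0, forall N, (N0 <= N)%N -> (e * primepi N <= N)%N.
Proof.
move=> e_gt0; exists (2 ^ (8 * e))%N => N N_ge.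
have N_gt0 : (0 < N)%N by apply: leq_trans N_ge; rewrite expn_gt0.
have /andP[pow_le pow_gt] := trunc_log_bounds (isT : 1 < 2)%N N_gt0.
have log_ge : (8 * e <= trunc_log 2 N)%N by apply: trunc_log_max.
move: (trunc_log 2 N) log_ge pow_le pow_gt => J log_ge pow_le /ltnW/leq_primepi pi_le.
have pow2_le : (J.+1 * primepi (2 ^ J.+1) <= 8 * 2 ^ J)%N.
  by apply: leq_trans (primepi_pow2 _) _; [lia | rewrite expnS mulnA].
by rewrite -(@leq_pmul2l 8) // mulnA; nia.
Qed.

Definition five_smooth (m : nat) : bool := [pred p : nat | (p <= 5)%N].-nat m.

Lemma five_smooth_ndvd p m : prime p -> (7 <= p)%N -> five_smooth m -> ~~ (p %| m)%N.
Proof.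
move=> p_pr p_ge7 m_smooth; have m_gt0 : (0 < m)%N by case/andP: m_smooth.
by apply/negP => /(pnatP _ m_gt0 m_smooth p p_pr); rewrite inE; lia.
Qed.

Definition sieve_bound (kappa : rat) (f : nat -> nat) (n : nat) : Prop :=
  forall p e, prime p -> (7 <= p)%N -> (0 < e)%N ->
    (\sum_(x < n) (p ^ e %| f x))%:R <= kappa * (n%:R / (p ^ e)%:R + 1).

Lemma eq_sieve_bound kappa f g n : f =1 g -> sieve_bound kappa f n -> sieve_bound kappa g n.
Proof.
move=> fg f_bound p e p_pr p_ge7 e_gt0.
by under eq_bigr => x _ do rewrite -fg; apply: f_bound.
Qed.

Lemma sieve_bound_le kappa kappa' f n :
  kappa <= kappa' -> sieve_bound kappa f n -> sieve_bound kappa' f n.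
Proof.
move=> le_kappa f_bound p e p_pr p_ge7 e_gt0; apply: le_trans (f_bound p e p_pr p_ge7 e_gt0) _.
by rewrite ler_wpM2r // addr_ge0 // divr_ge0.
Qed.

Lemma divn_le_divr (R : numFieldType) (n m : nat) : (0 < m)%N -> (n %/ m)%:R <= n%:R / m%:R :> R.
Proof. by move=> m_gt0; rewrite ler_pdivlMr ?ltr0n // -natrM ler_nat leq_divM. Qed.

Lemma sieve_bound_linear u v n : five_smooth u -> sieve_bound 1 (fun x => u * x + v)%N n.
Proof.
move=> u_smooth p e p_pr p_ge7 _.
have := count_linear e v n p_pr (five_smooth_ndvd p_pr p_ge7 u_smooth).
rewrite -(ler_nat rat) mul1r => /le_trans; apply.
by rewrite natrD lerD2r divn_le_divr // expn_gt0 prime_gt0.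
Qed.

Lemma sieve_bound_quadratic a u v k n :
  five_smooth a -> five_smooth u -> five_smooth k -> sieve_bound 2 (quadratic a u v k) n.
Proof.
move=> a_smooth u_smooth k_smooth p e p_pr p_ge7 e_gt0.
have ndvd := five_smooth_ndvd p_pr p_ge7.
have p_odd : odd p by have [p2|//] := even_prime p_pr; rewrite p2 in p_ge7.
have := count_quadratic v n p_pr p_odd (ndvd a a_smooth) (ndvd u u_smooth) (ndvd k k_smooth) e_gt0.
rewrite -(ler_nat rat) => /le_trans; apply.
by rewrite natrM natrD ler_pM2l // lerD2r divn_le_divr // expn_gt0 prime_gt0.
Qed.

Definition sq_divisors (M N a : nat) : nat := \sum_(M <= p < N | prime p) (p ^ 2 %| a).

Lemma sq_divisors_cat M N P a : (M <= N)%N -> (N <= P)%N ->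
  sq_divisors M P a = (sq_divisors M N a + sq_divisors N P a)%N.
Proof. by move=> le_MN le_NP; rewrite /sq_divisors (@big_cat_nat _ _ _ N). Qed.

Definition common_divisors (N a d : nat) : nat :=
  \sum_(7 <= q < N | prime q) ((q %| a) * (q %| d)).

Lemma common_divisorsC N a d : common_divisors N a d = common_divisors N d a.
Proof. by apply: eq_bigr => q _; rewrite mulnC. Qed.

Lemma sum_primes_const (M N : nat) (c : rat) :
  0 <= c -> \sum_(M <= p < N | prime p) c <= c * (primepi N)%:R.
Proof.
move=> c_ge0; have [le_NM|le_MN] := leqP N M.
  by rewrite big_geq // mulr_ge0.
rewrite /primepi natr_sum mulr_sumr [leRHS](@big_cat_nat _ _ _ M) //=; last exact: ltnW.
under [X in _ + X]eq_bigr => p _ do rewrite mulr1.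
by rewrite lerDr sumr_ge0 // => p _; rewrite mulr1.
Qed.

Lemma sum_sq_divisors_le kappa f n Z N : (6 <= Z)%N -> 0 <= kappa -> sieve_bound kappa f n ->
  (\sum_(x < n) sq_divisors Z.+1 N (f x))%:R
    <= kappa * (n%:R / (2 * Z%:R) + (primepi N)%:R) :> rat.
Proof.
move=> Z_ge6 kappa_ge0 f_bound; rewrite exchange_big /= natr_sum.
apply: (@le_trans _ _ (\sum_(Z.+1 <= p < N | prime p) (kappa * n%:R * (p%:R ^+ 2)^-1 + kappa))).
  rewrite big_nat_cond [leRHS]big_nat_cond; apply: ler_sum => p /andP[/andP[Z_lt_p _] p_pr].
  have := f_bound p 2%N p_pr (leq_trans (_ : 6 < Z.+1)%N Z_lt_p) isT.
  by rewrite natrX mulrDr mulr1 mulrA; apply.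
rewrite big_split /= -mulr_sumr mulrDr; apply: lerD; last exact: sum_primes_const.
rewrite -mulrA ler_wpM2l // ler_wpM2l //; apply: sum_inv_sqr_primes; lia.
Qed.

Lemma sum_sq_divisors7_le kappa f n N : 0 <= kappa -> sieve_bound kappa f n ->
  (\sum_(x < n) sq_divisors 7 N (f x))%:R <= kappa * (n%:R / 12 + (primepi N)%:R) :> rat.
Proof.
move=> kappa_ge0 f_bound; have := sum_sq_divisors_le N (leqnn 6) kappa_ge0 f_bound.
by have -> : (12 : rat) = 2 * 6%:R by [].
Qed.

Lemma sum_inv_prime_divisors_le f n N J : sieve_bound 2 f n -> (N <= 2 ^ J)%N ->
  \sum_(x < n) \sum_(7 <= q < N | prime q) (q %| f x)%:R / q%:R <= n%:R / 6 + 2 * J%:R :> rat.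
Proof.
move=> f_bound N_le; rewrite exchange_big /=.
apply: (@le_trans _ _ (\sum_(7 <= q < N | prime q) (2 * n%:R * (q%:R ^+ 2)^-1 + 2 * q%:R^-1))).
  rewrite big_nat_cond [leRHS]big_nat_cond; apply: ler_sum => q /andP[/andP[q_ge7 _] q_pr].
  have q_gt0 : 0 < q%:R :> rat by rewrite ltr0n prime_gt0.
  rewrite -mulr_suml -natr_sum ler_pdivrMr //.
  have := f_bound q 1%N q_pr q_ge7 isT; rewrite expn1 => /le_trans; apply.
  by rewrite le_eqVlt; apply/orP; left; apply/eqP; field; rewrite gt_eqF.
rewrite big_split /= -!mulr_sumr; apply: lerD; last by rewrite ler_pM2l // sum_inv_primes_le_log.
have := @sum_inv_sqr_primes 6 N isT; have : 0 <= n%:R :> rat by [].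
by move: (\sum_(_ <= _ < _ | _) _) (n%:R) => S m m_ge0 S_le; nra.
Qed.

Lemma sum_common_divisors_fixed_le (v : nat -> nat) len N J a :
    sieve_bound 2 v len -> (0 < a < 2 ^ J)%N ->
  (\sum_(i < len) common_divisors N a (v i))%:R
    <= 2 * len%:R * (\sum_(7 <= q < N | prime q) (q %| a)%:R / q%:R) + 2 * J%:R :> rat.
Proof.
move=> v_bound a_lt; rewrite exchange_big /= natr_sum.
apply: (@le_trans _ _ (\sum_(7 <= q < N | prime q) ((q %| a)%:R * (2 * (len%:R / q%:R + 1))))).
  rewrite big_nat_cond [leRHS]big_nat_cond; apply: ler_sum => q /andP[/andP[q_ge7 _] q_pr].
  have := v_bound q 1%N q_pr q_ge7 isT; rewrite expn1 => count_le.
  by rewrite -big_distrr /= natrM ler_wpM2l.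
have -> : \sum_(7 <= q < N | prime q) ((q %| a)%:R * (2 * (len%:R / q%:R + 1))) =
   2 * len%:R * (\sum_(7 <= q < N | prime q) (q %| a)%:R / q%:R) +
   2 * (\sum_(7 <= q < N | prime q) (q %| a))%:R :> rat.
  by rewrite natr_sum !mulr_sumr -big_split /=; apply: eq_bigr => q _; ring.
by rewrite lerD2l ler_pM2l // ler_nat sum_prime_divisors.
Qed.

Lemma sum_common_divisors_le f (v : nat -> nat -> nat) n len N J :
    sieve_bound 2 f n -> (N <= 2 ^ J)%N -> (forall x, (x < n)%N -> (0 < f x < 2 ^ J)%N) ->
    (forall x, sieve_bound 2 (v x) len) ->
  (\sum_(x < n) \sum_(i < len) common_divisors N (f x) (v x i))%:R
    <= len%:R * n%:R / 3 + 4 * len%:R * J%:R + 2 * n%:R * J%:R :> rat.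
Proof.
move=> f_bound N_le f_lt v_bound.
have row_le (x : 'I_n) := sum_common_divisors_fixed_le N (v_bound x) (f_lt x (ltn_ord x)).
rewrite natr_sum; apply: le_trans (ler_sum _ (fun x _ => row_le x)) _.
rewrite big_split /= -mulr_sumr sumr_const card_ord -mulr_natl.
apply: le_trans (lerD (ler_wpM2l _ (sum_inv_prime_divisors_le f_bound N_le)) (lexx _)) _.
  by rewrite mulr_ge0.
by rewrite le_eqVlt; apply/orP; left; apply/eqP; field.
Qed.

Lemma coprime30_ndvd p a : coprime a 30 -> prime p -> (p < 7)%N -> ~~ (p %| a)%N.
Proof.
move=> co_a30 p_pr p_lt7; have p_30 : (p %| 30)%N by case: p p_pr p_lt7 => [|[|[|[|[|[|[|]]]]]]].
apply/negP => p_a; have : (p %| gcdn a 30)%N by rewrite dvdn_gcd p_a.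
by rewrite (eqP co_a30) dvdn1 => /eqP p1; rewrite p1 in p_pr.
Qed.

Lemma sqfree_of_sq_divisors a N :
    (0 < a < N ^ 2)%N -> (forall p, prime p -> (p < 7)%N -> ~~ (p ^ 2 %| a)%N) ->
  sq_divisors 7 N a = 0%N -> sqfree a.
Proof.
move=> /andP[a_gt0 a_lt] small_ndvd no_divisor p p_pr; apply/negP => p2_a.
have [p_ge7|p_lt7] := leqP 7 p; last by case/negP: (small_ndvd p p_pr p_lt7).
have p_lt : (p < N)%N by rewrite -(@ltn_exp2r _ _ 2) // (leq_ltn_trans _ a_lt) // dvdn_leq.
move/eqP: no_divisor; rewrite sum_nat_seq_eq0 => /allP /(_ p).
by rewrite mem_index_iota p_ge7 p_lt p_pr p2_a => /(_ isT).
Qed.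

Lemma coprime_of_common_divisors a d N : (0 < a < N)%N -> (0 < d)%N -> coprime a 30 ->
  common_divisors N a d = 0%N -> coprime a d.
Proof.
move=> /andP[a_gt0 a_lt] d_gt0 co_a30 no_divisor; rewrite coprime_has_primes //.
apply/hasPn => p; rewrite /= !mem_primes a_gt0 d_gt0 => /and3P[p_pr _ p_d].
rewrite p_pr /=; have [p_ge7|p_lt7] := leqP 7 p; last exact: coprime30_ndvd.
apply/negP => p_a; have p_lt : (p < N)%N by rewrite (leq_ltn_trans _ a_lt) // dvdn_leq.
move/eqP: no_divisor; rewrite sum_nat_seq_eq0 => /allP /(_ p).
by rewrite mem_index_iota p_ge7 p_lt p_pr p_a p_d => /(_ isT).
Qed.

Lemma sqfree_sqr_succ w N (D := ((30 * w + 1) ^ 2 + 1)%N) :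
  (D < N ^ 2)%N -> sq_divisors 7 N D = 0%N -> sqfree D.
Proof.
move=> D_lt; apply: sqfree_of_sq_divisors; first by rewrite D_lt /D addn1.
move=> p p_pr p_lt7; apply/negP.
have D_mod : [/\ D %% 4 = 2, D %% 3 = 2 & D %% 5 = 2]%N by rewrite /D -mulnn; split; lia.
case: D_mod; case: p p_pr p_lt7 => [|[|[|[|[|[|[|]]]]]]] // _ _.
- by rewrite /dvdn => ->.
- by move=> _ D3 _ /(dvdn_trans (_ : 3 %| 3 ^ 2)%N) => /(_ isT); rewrite /dvdn D3.
- by move=> _ _ D5 /(dvdn_trans (_ : 5 %| 5 ^ 2)%N) => /(_ isT); rewrite /dvdn D5.
Qed.

Lemma admissible_of_sieve C A w y k NB NA (B := (30 * w + 1)%N) :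
    coprime A 30 -> (0 < A < NA ^ 2)%N -> (B ^ 2 + 1 < NB ^ 2)%N ->
    sq_divisors 7 NA A = 0%N -> sq_divisors 7 NB (B ^ 2 + 1) = 0%N -> coprime A (B ^ 2 + 1) ->
    A = (2 * y ^ 2 + k)%N -> (0 < y)%N ->
    ((A - C * y) ^ 2 <= k ^ 2 * (B ^ 2 + 1) <= (A + C * y) ^ 2)%N ->
  admissible C A B y k.
Proof.
move=> co_A30 A_lt B_lt A_sq B_sq co_AB AE y_gt0 window; split; split=> //.
- by have := coprime30_ndvd co_A30 (isT : prime 2) isT; rewrite dvdn2 negbK.
- by rewrite /B oddD oddM.
- apply: sqfree_of_sq_divisors A_lt _ A_sq => p p_pr p_lt7.
  by apply: contra (coprime30_ndvd co_A30 p_pr p_lt7); apply: dvdn_trans; apply: dvdn_exp.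
- exact: sqfree_sqr_succ B_lt B_sq.
Qed.

Lemma window_of_bracket (C A B y k : nat) :
    (A <= k * B + C * y)%N -> (k * (B + 1) <= A + C * y)%N ->
  ((A - C * y) ^ 2 <= k ^ 2 * (B ^ 2 + 1) <= (A + C * y) ^ 2)%N.
Proof.
move=> lo hi; apply/andP; split.
  apply: (@leq_trans ((k * B) ^ 2)); first by rewrite leq_exp2r // leq_subLR addnC.
  by rewrite expnMn leq_mul2l leq_addr orbT.
apply: (@leq_trans ((k * (B + 1)) ^ 2)); last by rewrite leq_exp2r.
by rewrite expnMn leq_mul2l sqrnD; apply/orP; right; lia.
Qed.

Lemma exists_lt_of_sum_lt n c (G : nat -> nat) :
  (\sum_(x < n) G x < n * c)%N -> exists2 x, (x < n)%N & (G x < c)%N.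
Proof.
have [/existsP[x G_x] _|] := boolP [exists x : 'I_n, (G x < c)%N]; first by exists x.
rewrite negb_exists => /forallP G_ge; rewrite ltnNge => /negP[].
rewrite -[X in (X * _)%N]card_ord -sum_nat_const; apply: leq_sum => x _.
by rewrite leqNgt.
Qed.

Lemma exists_zero_of_sum_lt n (G : nat -> nat) :
  (\sum_(x < n) G x < n)%N -> exists2 x, (x < n)%N & G x = 0%N.
Proof.
rewrite -[X in (_ < X)%N]muln1 => /exists_lt_of_sum_lt[x x_lt].
by rewrite ltnS leqn0 => /eqP; exists x.
Qed.

(** * Choice of the parameters *)

Lemma sq_divisors_dvd M N a b : (a %| b)%N -> (sq_divisors M N a <= sq_divisors M N b)%N.
Proof.
move=> a_b; apply: leq_sum => p _; case: (boolP (p ^ 2 %| a)%N) => // /dvdn_trans -> //.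
Qed.

Lemma quadratic_sqr_succ b i :
  quadratic 1 30 (30 * b + 1) 1 i = ((30 * (b + i) + 1) ^ 2 + 1)%N.
Proof. by rewrite /quadratic mul1n mulnDr addnCA addnA. Qed.

Lemma sieve_bound_sqr_succ b n : sieve_bound 2 (fun i => (30 * (b + i) + 1) ^ 2 + 1)%N n.
Proof.
apply: (@eq_sieve_bound _ (quadratic 1 30 (30 * b + 1) 1)); first exact: quadratic_sqr_succ.
exact: sieve_bound_quadratic.
Qed.

Lemma exists_sieved_critical X (B := fun w => (30 * w + 1)%N) (N := (100 * X)%N) :
    (0 < X)%N -> (1000 * primepi N <= N)%N ->
  exists w, [/\ (X <= w < 2 * X)%N, sq_divisors 7 N (B w ^ 2 + 1) = 0%N &
    sq_divisors 7 N (2 * B w ^ 2 + (2 * B w + 3)) = 0%N].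
Proof.
move=> X_gt0 pi_le.
have [|x x_lt /eqP] := @exists_zero_of_sum_lt X (fun x =>
    sq_divisors 7 N (quadratic 1 30 (30 * X + 1) 1 x) +
    sq_divisors 7 N (quadratic 1 60 (60 * X + 3) 5 x))%N.
  rewrite big_split /= -(ltr_nat rat) natrD.
  have B_bound : sieve_bound 2 (quadratic 1 30 (30 * X + 1) 1) X by apply: sieve_bound_quadratic.
  have A_bound : sieve_bound 2 (quadratic 1 60 (60 * X + 3) 5) X by apply: sieve_bound_quadratic.
  have B_le := sum_sq_divisors7_le N (ler0n _ _) B_bound.
  have A_le := sum_sq_divisors7_le N (ler0n _ _) A_bound.
  apply: le_lt_trans (lerD B_le A_le) _.
  have X_gt0' : 0 < X%:R :> rat by rewrite ltr0n.
  by move: pi_le; rewrite -(ler_nat rat) {2}/N !natrM; lra.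
rewrite addn_eq0 quadratic_sqr_succ => /andP[/eqP B_sq /eqP A_sq].
exists (X + x)%N; split=> //; first by lia.
apply/eqP; rewrite -leqn0; apply: leq_trans (eq_leq A_sq); apply: sq_divisors_dvd.
apply/dvdnP; exists 2%N.
by rewrite /quadratic /B -!mulnn; lia.
Qed.

(* With y = B and k = 2 B + 3 one has 2 A = (2 B + 1) ^ 2 + 5 for A = 2 y ^ 2 + k, and a common
   divisor of A and B ^ 2 + 1 divides 5. *)
Lemma admissible_critical C w N (B := (30 * w + 1)%N) (A := (2 * B ^ 2 + (2 * B + 3))%N) :
    (3 <= C)%N -> (A < N ^ 2)%N ->
    sq_divisors 7 N (B ^ 2 + 1) = 0%N -> sq_divisors 7 N A = 0%N ->
  admissible C A B B (2 * B + 3).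
Proof.
move=> C_ge3 A_lt B_sq A_sq.
have co_A30 : coprime A 30.
  by rewrite -coprime_modl (_ : A %% 30 = 7)%N // /A /B -mulnn; lia.
have co_AD : coprime A (B ^ 2 + 1).
  rewrite /coprime -dvdn1; set d := gcdn A (B ^ 2 + 1).
  suff : (d %| gcdn A 30)%N by rewrite (eqP co_A30).
  have [d_A d_D] : (d %| A)%N /\ (d %| B ^ 2 + 1)%N by rewrite dvdn_gcdl dvdn_gcdr.
  rewrite dvdn_gcd d_A (dvdn_trans (_ : d %| 5)%N) //.
  have d_2B1 : (d %| 2 * B + 1)%N.
    rewrite -(@dvdn_addr (2 * (B ^ 2 + 1))) ?dvdn_mull //.
    by have -> : (2 * (B ^ 2 + 1) + (2 * B + 1) = A)%N by rewrite /A; lia.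
  rewrite -(@dvdn_addr ((2 * B + 1) * (2 * B + 1))) ?dvdn_mull //.
  have -> : ((2 * B + 1) * (2 * B + 1) + 5 = 4 * (B ^ 2 + 1) + 2 * (2 * B + 1))%N.
    by rewrite -mulnn; lia.
  by rewrite dvdn_add // dvdn_mull.
apply: admissible_of_sieve co_A30 _ _ A_sq B_sq co_AD erefl _ _.
- by rewrite A_lt /A; lia.
- by apply: leq_ltn_trans A_lt; rewrite /A; lia.
- by rewrite /B; lia.
by apply: window_of_bracket; rewrite /A /B -?mulnn; nia.
Qed.

Lemma abundant_critical (m : nat) : (0 < m)%N -> abundant_parameters m (2 * m).
Proof.
move=> m_gt0; have [N0 pi_le] := @primepi_density 1000 isT.
have [C C_ge] : exists C, (100 * 100 <= C)%N by eexists; apply: leqnn.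
exists C => [|T0]; first by lia.
pose T := (T0 + N0 + 1)%N; have [X XE] : exists X, X = (T ^ m)%N by eexists.
have T_le_X : (T <= X)%N by rewrite XE -{1}(expn1 T) leq_pexp2l // /T addn1.
have X_gt0 : (0 < X)%N by apply: leq_trans T_le_X; rewrite /T addn1.
have [|w [/andP[w_ge w_lt] B_sq A_sq]] := @exists_sieved_critical X X_gt0.
  by apply: pi_le; rewrite /T in T_le_X; lia.
pose B := (30 * w + 1)%N; pose A := (2 * B ^ 2 + (2 * B + 3))%N.
have [B_ge B_lt] : (X <= B)%N /\ (B < 60 * X)%N by rewrite /B; lia.
exists T, A, B, B, (2 * B + 3)%N; split.
- by rewrite /T; lia.
- apply: admissible_critical B_sq A_sq; first by lia.
  by rewrite -/B -/A /A -!mulnn; nia.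
- by apply: commensurate_nat; rewrite -XE; nia.
by rewrite [(2 * m)%N]mulnC expnM -XE; apply: commensurate_nat; rewrite /A -!mulnn; nia.
Qed.

Lemma sum_disjoint_intervals (b : nat -> nat) len Y (g : nat -> nat) :
    (forall x, (b x + len <= b x.+1)%N) ->
  (\sum_(x < Y) \sum_(i < len) g (b x + i) <= \sum_(i < b Y - b 0) g (b 0 + i))%N.
Proof.
move=> step.
have b_ge x : (b 0 <= b x)%N.
  by elim: x => // x IHx; apply: leq_trans IHx _; apply: leq_trans (step x); apply: leq_addr.
elim: Y => [|Y IHY]; first by rewrite big_ord0.
rewrite big_ord_recr /=; apply: leq_trans (leq_add IHY (leqnn _)) _.
have -> : (b Y.+1 - b 0 = (b Y - b 0) + (len + (b Y.+1 - (b Y + len))))%N.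
  by have := step Y; have := b_ge Y; lia.
rewrite !big_split_ord /= leq_add2l.
apply: leq_trans (leq_addr _ _); apply: eq_leq; apply: eq_bigr => i _.
by congr g; have := b_ge Y; lia.
Qed.

Lemma subcritical_budget (r y j piB piA : rat) :
    1 <= r -> 1000 <= y -> 100 * j <= y -> 100 * j <= r ->
    piB <= 2 * (r * y) -> 100 * piA <= y ->
  2 * ((180 * (r * y) + 24 * r + 1) / 12 + piB) + 120 * r * (2 * (y / 12 + piA)) +
    (120 * r * y / 3 + 4 * (120 * r) * j + 2 * y * j) < y * (120 * r).
Proof.
move=> r_ge y_ge jy jr piB_le piA_le; have r_gt0 : 0 < r by lra.
have y_ge0 : 0 <= y by lra.
have := ler_wpM2l (ltW r_gt0) piA_le; have := ler_wpM2l (ltW r_gt0) jy.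
have := ler_wpM2l y_ge0 jr; have := ler_wpM2l (ltW r_gt0) y_ge.
by lra.
Qed.

Lemma coprime30_quadratic s Y x : coprime (quadratic 2 30 (30 * Y + 6) (5 ^ s) x) 30.
Proof.
have pow5_mod : [\/ 5 ^ s %% 30 = 1, 5 ^ s %% 30 = 5 | 5 ^ s %% 30 = 25]%N.
  elim: s => [|s]; first by constructor 1.
  by rewrite expnS; case=> mod30; [constructor 2 | constructor 3 | constructor 2]; lia.
have -> : quadratic 2 30 (30 * Y + 6) (5 ^ s) x =
    (30 * (60 * (x + Y) ^ 2 + 24 * (x + Y) + 2) + (12 + 5 ^ s))%N.
  by rewrite /quadratic -!mulnn; move: (5 ^ s)%N => k; lia.
rewrite -coprime_modl mulnC modnMDl -modnDmr.
by case: pow5_mod => ->.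
Qed.

Section Subcritical.

Variables (s R Y J NB NA : nat).

Local Notation k := (5 ^ s)%N.
Local Notation len := (120 * R)%N.

Hypotheses (YE : Y = (k * R)%N) (R_gt0 : (0 < R)%N) (Y_ge : (1000 <= Y)%N).
Hypotheses (NBE : NB = (20 * 1000 * (R * Y))%N) (NAE : NA = (100 * Y)%N).
Hypothesis piB_le : (10 * 1000 * primepi NB <= NB)%N.
Hypothesis piA_le : (10 * 1000 * primepi NA <= NA)%N.
Hypotheses (J_ge : (NA ^ 2 <= 2 ^ J)%N) (JY : (100 * J <= Y)%N) (JR : (100 * J <= R)%N).

Local Notation A := (quadratic 2 30 (30 * Y + 6) k).
Local Notation b x := (A x %/ (30 * k))%N.
Local Notation B x i := (30 * (b x + i) + 1)%N.

Let k_gt0 : (0 < k)%N. Proof. by rewrite expn_gt0. Qed.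
Let k_le_Y : (k <= Y)%N. Proof. by rewrite YE leq_pmulr. Qed.
Let k30_gt0 : (0 < 30 * k)%N. Proof. by rewrite muln_gt0. Qed.

Lemma subcritical_step x : (b x + len <= b x.+1)%N.
Proof.
rewrite addnC -divnMDl // leq_div2r //.
have -> : (len * (30 * k) = 3600 * Y)%N by rewrite YE; move: k => k'; lia.
by rewrite /quadratic -!mulnn; move: k k_le_Y => k' _; nia.
Qed.

Lemma subcritical_range : (b Y - b 0 <= 180 * (R * Y) + 24 * R + 1)%N.
Proof.
have last_le : (b Y * (30 * k) <= A Y)%N by apply: leq_divM.
have first_lt : (A 0 < (b 0 + 1) * (30 * k))%N by rewrite addn1; apply: ltn_ceil.
have AYE : A Y = (A 0 + 30 * k * (180 * (R * Y) + 24 * R))%N.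
  rewrite /quadratic.
  have -> : (30 * k * (180 * (R * Y) + 24 * R) = 54 * 100 * (Y * Y) + 720 * Y)%N.
    by rewrite YE; move: k => k'; lia.
  by rewrite -!mulnn muln0 add0n; move: k => k'; lia.
rewrite leq_subLR -ltnS -(ltn_pmul2r k30_gt0); apply: leq_ltn_trans last_le _; rewrite AYE.
by move: first_lt; move: (b 0) (A 0) (180 * (R * Y) + 24 * R)%N k => u v w k'; nia.
Qed.

Lemma subcritical_bounds x : (x <= Y)%N -> (1800 * Y ^ 2 <= A x < NA ^ 2)%N.
Proof.
move=> x_le; rewrite NAE /quadratic -!mulnn; move: k k_le_Y => k' k'_le.
by clear -x_le Y_ge k'_le; apply/andP; split; nia.
Qed.

Lemma subcritical_sieve_bound : sieve_bound 2 A Y.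
Proof. by apply: sieve_bound_quadratic; rewrite // /five_smooth pnatX. Qed.

Lemma sum_subcritical_sq_divisors N :
  (\sum_(x < Y) \sum_(i < len) sq_divisors 7 N (B x i ^ 2 + 1))%:R <=
    2 * ((180 * (R%:R * Y%:R) + 24 * R%:R + 1) / 12 + (primepi N)%:R) :> rat.
Proof.
pose g c := sq_divisors 7 N ((30 * c + 1) ^ 2 + 1).
have := sum_disjoint_intervals Y g subcritical_step; rewrite -(ler_nat rat) => /le_trans; apply.
have g_bound := @sieve_bound_sqr_succ (b 0) (b Y - b 0).
apply: le_trans (sum_sq_divisors7_le N (ler0n _ _) g_bound) _.
have := subcritical_range; rewrite -(ler_nat rat).
by move: (b Y - b 0)%:R (primepi N)%:R => range piN; lra.
Qed.

Lemma sum_subcritical_common :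
  (\sum_(x < Y) \sum_(i < len) common_divisors (NA ^ 2) (A x) (B x i ^ 2 + 1))%:R <=
    len%:R * Y%:R / 3 + 4 * len%:R * J%:R + 2 * Y%:R * J%:R :> rat.
Proof.
apply: (sum_common_divisors_le (v := fun x i => (B x i ^ 2 + 1)%N) subcritical_sieve_bound J_ge)
  => x; last exact: sieve_bound_sqr_succ.
move=> /ltnW/subcritical_bounds /andP[_ /leq_trans ->] //.
by rewrite /quadratic addn_gt0 k_gt0 orbT.
Qed.

Lemma exists_sieved_subcritical : exists x i : nat, [/\ (x < Y)%N, (i < len)%N,
  sq_divisors 7 NB (B x i ^ 2 + 1) = 0%N, sq_divisors 7 NA (A x) = 0%N &
  common_divisors (NA ^ 2) (A x) (B x i ^ 2 + 1) = 0%N].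
Proof.
pose sqB x i := sq_divisors 7 NB (B x i ^ 2 + 1).
pose sqA x := sq_divisors 7 NA (A x).
pose common x i := common_divisors (NA ^ 2) (A x) (B x i ^ 2 + 1).
pose defects x i := (sqB x i + sqA x + common x i)%N.
suff [x x_lt row_lt] : exists2 x, (x < Y)%N & (\sum_(i < len) defects x i < len)%N.
  have [i i_lt /eqP] := exists_zero_of_sum_lt (G := defects x) row_lt.
  by rewrite !addn_eq0 => /andP[/andP[/eqP ? /eqP ?] /eqP ?]; exists x, i.
apply: (exists_lt_of_sum_lt (G := fun x => \sum_(i < len) defects x i)%N).
have -> : (\sum_(x < Y) \sum_(i < len) defects x i =
   \sum_(x < Y) \sum_(i < len) sqB x i + len * \sum_(x < Y) sqA x +
   \sum_(x < Y) \sum_(i < len) common x i)%N.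
  rewrite big_distrr /= -!big_split /=; apply: eq_bigr => x _.
  by rewrite !big_split /= sum_nat_const card_ord.
have sqA_le := sum_sq_divisors7_le NA (ler0n _ _) subcritical_sieve_bound.
rewrite -(ltr_nat rat) !natrD (natrM _ len) (natrM _ Y len).
apply: le_lt_trans (lerD (lerD (sum_subcritical_sq_divisors NB)
  (ler_wpM2l (ler0n _ _) sqA_le)) sum_subcritical_common) _.
have -> : len%:R = 120 * R%:R :> rat by rewrite natrM.
apply: subcritical_budget.
- by rewrite ler1n.
- by have := Y_ge; rewrite -(ler_nat rat).
- by have := JY; rewrite -(ler_nat rat) natrM.
- by have := JR; rewrite -(ler_nat rat) natrM.
- by have := piB_le; rewrite -(ler_nat rat) {2}NBE; lra.
by have := piA_le; rewrite -(ler_nat rat) {2}NAE; lra.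
Qed.

Lemma exists_admissible_subcritical C : (20 * 1000 <= C)%N ->
  exists A' B' y : nat, [/\ admissible C A' B' y k,
    (R * Y <= B')%N /\ (B' <= C * (R * Y))%N & (Y ^ 2 <= A')%N /\ (A' <= C * Y ^ 2)%N].
Proof.
move=> C_ge; have [x [i [x_lt i_lt B_sq A_sq AB_common]]] := exists_sieved_subcritical.
have /andP[A_ge A_lt] := subcritical_bounds (ltnW x_lt).
have A_gt0 : (0 < A x)%N by rewrite /quadratic addn_gt0 k_gt0 orbT.
have co_A30 : coprime (A x) 30 by exact: coprime30_quadratic.
have b_le : (b x * (30 * k) <= A x)%N by apply: leq_divM.
have b_gt : (A x < (b x + 1) * (30 * k))%N by rewrite addn1; apply: ltn_ceil.
have kRY : (k * (R * Y) = Y * Y)%N by rewrite mulnA -YE.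
have b_ge : (60 * (R * Y) <= b x)%N.
  rewrite leq_divRL // (leq_trans _ A_ge) // -mulnn -kRY; move: k => k'; lia.
have b_le' : (b x <= 334 * (R * Y))%N.
  rewrite -(leq_pmul2r k30_gt0); apply: leq_trans b_le (leq_trans (ltnW A_lt) _).
  have -> : (334 * (R * Y) * (30 * k) = 334 * 30 * (k * (R * Y)))%N by move: k => k'; lia.
  by rewrite kRY NAE -mulnn; clear; nia.
have RY_ge : (1000 <= R * Y)%N by apply: leq_trans Y_ge _; rewrite leq_pmull.
have R_le : (R <= R * Y)%N by rewrite leq_pmulr //; apply: leq_trans Y_ge.
have B_le : (B x i <= 15 * 1000 * (R * Y))%N.
  by move: b_le' R_le i_lt RY_ge; move: (b x) (R * Y)%N => u v; clear; lia.
have y_ge : (30 * Y <= 30 * x + (30 * Y + 6))%N by clear; lia.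
exists (A x), (B x i), (30 * x + (30 * Y + 6))%N; split.
- apply: (admissible_of_sieve co_A30 _ _ A_sq B_sq _ erefl).
  + by rewrite A_gt0.
  + rewrite NBE -!mulnn; move: B_le RY_ge; move: (B x i) (R * Y)%N => u v; clear; nia.
  + by apply: coprime_of_common_divisors AB_common; rewrite ?A_gt0 ?addn1.
  + by rewrite addn_gt0 addnS orbT.
  apply: window_of_bracket.
    apply: (@leq_trans (k * B x i + 30 * k)).
      by move: b_gt; move: (A x) (b x) k => u v k'; clear; nia.
    by rewrite leq_add2l leq_mul //; [clear -C_ge; lia | apply: leq_trans k_le_Y _; lia].
  apply: (@leq_trans (A x + (30 * (k * len) + 2 * k))).
    by move: b_le i_lt; move: (A x) (b x) k => u v k'; clear; nia.
  have -> : (k * len = 120 * Y)%N by rewrite YE; move: k => k'; clear; lia.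
  rewrite leq_add2l; apply: (@leq_trans (C * (30 * Y))); last by rewrite leq_mul.
  by move: C_ge k_le_Y; move: k => k'; clear; nia.
- split; last by apply: leq_trans B_le _; rewrite leq_mul2r; apply/orP; right; clear -C_ge; lia.
  by move: b_ge; move: (b x) (R * Y)%N => u v; clear; lia.
split; first by apply: leq_trans A_ge; rewrite leq_pmull.
by apply: leq_trans (ltnW A_lt) _; rewrite NAE expnMn leq_mul2r; apply/orP; right; clear -C_ge; lia.
Qed.

End Subcritical.

Lemma exists_exponent b c N : (4 <= b)%N ->
  exists j, [/\ (0 < j)%N, (N <= b ^ j)%N & (c * j <= b ^ j)%N].
Proof.
move=> b_ge4; pose j := (N + c + 1)%N; have j_lt : (j < 2 ^ j)%N by rewrite ltn_expl.
have sqr_le : (j * j <= b ^ j)%N.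
  apply: (@leq_trans (2 ^ j * 2 ^ j)); first by rewrite leq_mul // ltnW.
  by rewrite -expnMn leq_exp2r // /j addn1.
exists j; split; first by rewrite /j addn1.
  by apply: leq_trans sqr_le; rewrite /j; nia.
by apply: leq_trans sqr_le; rewrite leq_mul2r /j; apply/orP; right; lia.
Qed.

Lemma leq_self_exp t d : (0 < t)%N -> (0 < d)%N -> (t <= t ^ d)%N.
Proof. by move=> t_gt0 d_gt0; rewrite -{1}(expn1 t) leq_pexp2l. Qed.

Lemma abundant_subcritical (m n : nat) :
  (0 < m)%N -> (m <= n)%N -> (n < 2 * m)%N -> abundant_parameters m n.
Proof.
move=> m_gt0 m_le_n n_lt_2m; have n_gt0 : (0 < n)%N by apply: leq_trans m_le_n.
have [N0 pi_le] := @primepi_density (10 * 1000) isT.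
have [C C_ge] : exists C, (20 * 1000 <= C)%N by eexists; apply: leqnn.
have C_gt0 : (0 < C)%N by apply: leq_trans C_ge.
exists C => // T0.
have [j [j_gt0 N_le cj_le]] :=
  exists_exponent (1400 + 500 * n) (T0 + N0 + 1000) (isT : 4 <= 5)%N.
have [t tE] : exists t, t = (5 ^ j)%N by eexists.
rewrite -tE in N_le cj_le; have t_gt0 : (0 < t)%N by rewrite tE expn_gt0.
have [R RE] : exists R, R = (t ^ (2 * m - n))%N by eexists.
have [Y YE] : exists Y, Y = (t ^ n)%N by eexists.
pose s := (j * (2 * (n - m)))%N; pose J := (14 + 5 * (j * n))%N.
have t_le_Y : (t <= Y)%N by rewrite YE leq_self_exp.
have t_le_R : (t <= R)%N by rewrite RE leq_self_exp // subn_gt0.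
have J_le : (100 * J <= t)%N by apply: leq_trans cj_le; rewrite /J; clear -j_gt0; nia.
have kRE : Y = (5 ^ s * R)%N.
  by rewrite YE RE /s expnM -tE -expnD; congr expn; clear -m_le_n n_lt_2m; lia.
have J_ge : ((100 * Y) ^ 2 <= 2 ^ J)%N.
  have -> : ((100 * Y) ^ 2 = 100 ^ 2 * (5 ^ 2) ^ (j * n))%N.
    by rewrite expnMn YE tE -!expnM; congr (_ * 5 ^ _)%N; clear; lia.
  by rewrite /J expnD (expnM 2 5) leq_mul // leq_exp2r // muln_gt0 j_gt0.
have piB_le : (10 * 1000 * primepi (20 * 1000 * (R * Y)) <= 20 * 1000 * (R * Y))%N.
  by apply: pi_le; clear -N_le t_le_R t_le_Y t_gt0; nia.
have piA_le : (10 * 1000 * primepi (100 * Y) <= 100 * Y)%N.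
  by apply: pi_le; clear -N_le t_le_Y; lia.
have [||A [B [y [ABy_adm [B_ge B_le] [A_ge A_le]]]]] := exists_admissible_subcritical kRE _
  _ erefl erefl piB_le piA_le J_ge (leq_trans J_le t_le_Y) (leq_trans J_le t_le_R) C_ge.
- exact: leq_trans t_le_R.
- by clear -N_le t_le_Y; lia.
have RYE : (R * Y = (t ^ 2) ^ m)%N.
  by rewrite RE YE -expnD -expnM; congr expn; clear -m_le_n n_lt_2m; lia.
have Y2E : (Y ^ 2 = (t ^ 2) ^ n)%N by rewrite YE -!expnM mulnC.
exists (t ^ 2)%N, A, B, y, (5 ^ s)%N; split=> //.
- by apply: leq_trans (leq_self_exp t_gt0 (isT : 0 < 2)%N); clear -N_le; lia.
- by rewrite -RYE; apply: commensurate_nat => //; apply: leq_trans B_ge _; rewrite leq_pmull.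
- by rewrite -Y2E; apply: commensurate_nat => //; apply: leq_trans A_ge _; rewrite leq_pmull.
Qed.

(* The largest k with k sqrt (B ^ 2 + 1) <= 2 y ^ 2 + k. *)
Definition crossing (B y : nat) : nat :=
  \max_(k < (2 * y ^ 2).+1 | (k ^ 2 * (B ^ 2 + 1) <= (2 * y ^ 2 + k) ^ 2)%N) k.

Lemma below_crossing B y k :
  (k ^ 2 * (B ^ 2 + 1) <= (2 * y ^ 2 + k) ^ 2)%N -> (k * B <= 2 * y ^ 2 + k)%N.
Proof.
rewrite -(@leq_exp2r (k * B) _ 2) // => /(leq_trans _) -> //.
by rewrite expnMn leq_mul2l leq_addr orbT.
Qed.

Lemma above_crossing B y k :
  ((2 * y ^ 2 + k) ^ 2 < k ^ 2 * (B ^ 2 + 1))%N -> (2 * y ^ 2 < k * B)%N.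
Proof.
move=> above; have : (2 * y ^ 2 + k < k * (B + 1))%N.
  rewrite -(@ltn_exp2r _ _ 2) // (leq_trans above) // expnMn leq_mul2l sqrnD.
  by apply/orP; right; lia.
by move: (y ^ 2)%N => z; rewrite mulnDr; lia.
Qed.

Lemma crossing_le B y :
  (crossing B y ^ 2 * (B ^ 2 + 1) <= (2 * y ^ 2 + crossing B y) ^ 2)%N.
Proof.
pose P := [pred k : 'I_(2 * y ^ 2).+1 | k ^ 2 * (B ^ 2 + 1) <= (2 * y ^ 2 + k) ^ 2]%N.
have [|k k_P maxE] := @eq_bigmax_cond _ P (fun k => k : nat).
  by apply/card_gt0P; exists ord0; rewrite inE /= exp0n.
by rewrite -[crossing B y]/(\max_(k in P) k)%N maxE.
Qed.

Lemma crossing_lt B y k : (2 <= B)%N -> (crossing B y < k)%N ->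
  ((2 * y ^ 2 + k) ^ 2 < k ^ 2 * (B ^ 2 + 1))%N.
Proof.
move=> B_ge2; rewrite !ltnNge; apply: contra => k_below.
have k_lt : (k < (2 * y ^ 2).+1)%N.
  by have := below_crossing k_below; move: (y ^ 2)%N => z; nia.
exact: (@leq_bigmax_cond _ _ (fun k : 'I_(2 * y ^ 2).+1 => k : nat) (Ordinal k_lt)).
Qed.

Lemma crossing_add_le B y e :
  ((crossing B y + e) ^ 2 * (B ^ 2 + 1) <= (2 * y ^ 2 + crossing B y + e * (B + 1)) ^ 2)%N.
Proof.
have := crossing_le B y; have : (B ^ 2 + 1 <= (B + 1) ^ 2)%N by rewrite sqrnD; lia.
move: (2 * y ^ 2 + crossing B y)%N => u; move: (crossing B y) (B ^ 2 + 1)%N (B + 1)%N.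
move=> k D b D_le kD_le.
have mul_le : (k * D <= u * b)%N.
  rewrite -(@leq_exp2r _ _ 2) // !expnMn -[X in (_ * X <= _)%N]mulnn mulnA.
  by apply: leq_mul.
rewrite -!mulnn in kD_le D_le *.
have := leq_mul (leqnn e) mul_le; have := leq_mul (leqnn (e * e)) D_le.
by lia.
Qed.

Lemma sum_comp_le (I : finType) (F : I -> nat) (g : nat -> nat) L M :
    (forall z, (F z < M)%N) -> (forall a, \sum_z (F z == a) <= L)%N ->
  (\sum_z g (F z) <= L * \sum_(a < M) g a)%N.
Proof.
move=> F_lt fiber_le.
have -> : (\sum_z g (F z) = \sum_(a < M) (\sum_z (F z == a)) * g a)%N.
  under [RHS]eq_bigr => a _ do rewrite big_distrl /=.
  rewrite exchange_big; apply: eq_bigr => z _ /=.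
  rewrite (bigD1 (Ordinal (F_lt z))) //= eqxx mul1n big1 ?addn0 // => a a_neq.
  by rewrite -val_eqE eq_sym in a_neq; rewrite (negPf a_neq).
by rewrite big_distrr /=; apply: leq_sum => a _; rewrite leq_mul2r fiber_le orbT.
Qed.

Lemma supercritical_budget (x y l j piB : rat) :
    y = l * x -> 1000 <= x -> 1000 <= l -> 100 * piB <= x -> 100 * j <= x -> 100 * j <= l ->
  y * (60 * l) * (2 * (x / 12 + piB)) + x * y * (60 * l / 12 + (l + 1)) +
    l * (16 * y ^+ 2 / (2 * l) + 4 * y) +
    y * (60 * l * x / 3 + 4 * (60 * l) * j + 2 * x * j) < x * (y * (60 * l)).
Proof.
move=> -> x_ge l_ge pi_le jx jl; have l_gt0 : 0 < l by lra.
have x_gt0 : 0 < x by lra.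
have lx_gt0 : 0 < l * x by rewrite mulr_gt0.
have llx_gt0 : 0 < l * (l * x) := mulr_gt0 l_gt0 lx_gt0.
have lxx_gt0 : 0 < l * x * x := mulr_gt0 lx_gt0 x_gt0.
have llxx_gt0 : 0 < l * x * (l * x) := mulr_gt0 lx_gt0 lx_gt0.
have -> : l * (16 * (l * x) ^+ 2 / (2 * l) + 4 * (l * x)) =
    8 * (l * x * (l * x)) + 4 * (l * (l * x)) by field; rewrite gt_eqF.
have := ler_wpM2l (ltW llx_gt0) pi_le; have := ler_wpM2l (ltW llx_gt0) jx.
have := ler_wpM2l (ltW lxx_gt0) jl; have := ler_wpM2l (ltW llx_gt0) x_ge.
have := ler_wpM2l (ltW lxx_gt0) l_ge.
by lra.
Qed.

Lemma windows_disjoint_arith X L z k k' E b b' :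
    (0 < X)%N -> (200 * 1000 <= L)%N -> (E <= 30 * (62 * L))%N -> ((L * X) ^ 2 <= z)%N ->
    (2 * z < k * b)%N -> (k <= k' + E)%N -> (k' * b' <= 2 * z + k')%N ->
    (b + 30 <= b')%N -> (b' <= 60 * X)%N ->
  False.
Proof.
move=> X_gt0 L_ge E_le z_ge kb_gt k_le k'b'_le bb' b'_le.
have k_small : (29 * k <= E * (60 * X))%N.
  have k'_le : (k' * (b' - 1) <= 2 * z)%N by rewrite mulnBr muln1; lia.
  have k_le' : (k * (b' - 1) <= k' * (b' - 1) + E * (b' - 1))%N.
    by rewrite -mulnDl leq_mul2r k_le orbT.
  have kb_le : (k * (b + 29) <= k * (b' - 1))%N.
    by rewrite leq_mul2l; apply/orP; right; clear -bb'; lia.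
  have Eb'_le : (E * (b' - 1) <= E * (60 * X))%N.
    by rewrite leq_mul2l; apply/orP; right; clear -b'_le; lia.
  by move: kb_le; rewrite mulnDr; clear -k'_le k_le' Eb'_le kb_gt; lia.
have sqr_le : (29 * (2 * (L * X) ^ 2) <= 30 * (62 * L) * (60 * X) * (60 * X))%N.
  apply: (@leq_trans (29 * (k * b))).
    by rewrite leq_mul2l (leq_trans _ (ltnW kb_gt)) ?orbT // leq_mul2l z_ge orbT.
  rewrite mulnA; apply: leq_mul; last by clear -bb' b'_le; lia.
  by apply: leq_trans k_small _; rewrite leq_mul2r E_le orbT.
have LXX_gt0 : (0 < L * (X * X))%N by rewrite !muln_gt0 X_gt0 (leq_trans _ L_ge).
have : (58 * L <= 30 * 62 * 3600)%N.
  rewrite -(leq_pmul2r LXX_gt0).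
  have -> : (58 * L * (L * (X * X)) = 29 * (2 * (L * X) ^ 2))%N by rewrite -mulnn; clear; lia.
  by apply: leq_trans sqr_le _; clear; lia.
by clear -L_ge; lia.
Qed.

Section Supercritical.

Variables (X L Y J NB : nat).

Local Notation len := (60 * L)%N.

Hypotheses (YE : Y = (L * X)%N) (X_ge : (1000 <= X)%N) (L_ge : (200 * 1000 <= L)%N).
Hypotheses (NBE : NB = (100 * X)%N) (pi_le : (10 * 1000 * primepi NB <= NB)%N).
Hypotheses (J_ge : (16 * Y ^ 2 <= 2 ^ J)%N) (JX : (100 * J <= X)%N) (JL : (100 * J <= L)%N).

Let B x := (30 * (X + x) + 1)%N.
Let cross x y := crossing (B x) (Y + y).
Let start x y := ((2 * (Y + y) ^ 2 + cross x y) %/ 30 + 1)%N.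
Let A x y i := (30 * (start x y + i) + 1)%N.

Let X_gt0 : (0 < X)%N. Proof. exact: leq_trans X_ge. Qed.
Let L_gt0 : (0 < L)%N. Proof. exact: leq_trans L_ge. Qed.
Let Y_gt0 : (0 < Y)%N. Proof. by rewrite YE muln_gt0 L_gt0. Qed.
Let L_le_Y : (L <= Y)%N. Proof. by rewrite YE leq_pmulr. Qed.
Let B_ge2 x : (2 <= B x)%N. Proof. by rewrite /B; lia. Qed.

Lemma supercritical_bound x y n : sieve_bound 1 (A x y) n.
Proof.
apply: (@eq_sieve_bound _ (fun i => 30 * i + (30 * start x y + 1))%N);
  last exact: sieve_bound_linear.
by move=> i; rewrite /A mulnDr addnCA addnA.
Qed.

Lemma supercritical_lower x y i : (2 * (Y + y) ^ 2 + cross x y < A x y i)%N.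
Proof.
rewrite /A /start; have := divn_eq (2 * (Y + y) ^ 2 + cross x y) 30.
have := @ltn_pmod (2 * (Y + y) ^ 2 + cross x y) 30 isT.
by move: (2 * (Y + y) ^ 2 + cross x y)%N (_ %/ _)%N (_ %% _)%N; clear; lia.
Qed.

Lemma supercritical_upper x y i :
  (i < len)%N -> (A x y i <= 2 * (Y + y) ^ 2 + cross x y + 30 * (len + 2))%N.
Proof.
rewrite /A /start; have := divn_eq (2 * (Y + y) ^ 2 + cross x y) 30.
by move: (2 * (Y + y) ^ 2 + cross x y)%N (_ %/ _)%N (_ %% _)%N; clear; lia.
Qed.

Lemma supercritical_crossing_le x y : (y < Y)%N -> (30 * cross x y <= 8 * (L * Y))%N.
Proof.
move=> y_lt; have := below_crossing (crossing_le (B x) (Y + y)); rewrite -/(cross x y).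
have sqr_le : ((Y + y) ^ 2 <= 4 * (Y * Y))%N by rewrite -mulnn; clear -y_lt; nia.
move: sqr_le; move: (cross x y) ((Y + y) ^ 2)%N => k z z_le; rewrite /B => kB_le.
rewrite -(leq_pmul2r X_gt0); apply: (@leq_trans (8 * (Y * Y))).
  by clear -X_gt0 z_le kB_le; nia.
by rewrite {1}YE; clear; lia.
Qed.

Lemma supercritical_window x y i :
  (y < Y)%N -> (i < len)%N -> (A x y i <= 2 * (Y + y) ^ 2 + L * Y)%N.
Proof.
move=> y_lt i_lt; have := supercritical_upper x y i_lt.
have := supercritical_crossing_le x y_lt.
have : (30 * (30 * (len + 2)) <= 22 * (L * Y))%N.
  have : (L * 200 * 1000 <= L * Y)%N by rewrite -mulnA leq_mul2l (leq_trans L_ge) ?orbT.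
  by clear -L_gt0; lia.
by move: (A x y i) (2 * (Y + y) ^ 2)%N (cross x y) (L * Y)%N (30 * (len + 2))%N; clear; lia.
Qed.

Lemma supercritical_lt x y i : (y < Y)%N -> (i < len)%N -> (A x y i < 16 * Y ^ 2)%N.
Proof.
move=> y_lt i_lt; apply: leq_ltn_trans (supercritical_window x y_lt i_lt) _.
have : (L * Y <= Y * Y)%N by apply: leq_mul.
by rewrite -!mulnn; clear -y_lt; nia.
Qed.

(* If A lies in the windows of B x < B x', then k = A - 2 z with z = (Y + y) ^ 2 satisfies
   2 z < k B x and 2 z >= (k - 30 (len + 2)) (B x' - 1): so k is at most of order len X,
   whereas it is at least of order Y ^ 2 / X. *)
Lemma supercritical_disjoint x x' y i i' : (y < Y)%N -> (x < x')%N -> (x' < X)%N ->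
  (i' < len)%N -> A x y i = A x' y i' -> False.
Proof.
move=> y_lt lt_xx' x'_lt i'_lt AE.
have lo := supercritical_lower x y i; have := supercritical_upper x' y i'_lt; rewrite -AE => hi.
have k'_le := below_crossing (crossing_le (B x') (Y + y)); rewrite -/(cross x' y) in k'_le.
set z := ((Y + y) ^ 2)%N in lo hi k'_le; pose k := (A x y i - 2 * z)%N.
have k_gt : (2 * z < k * B x)%N.
  apply/above_crossing/crossing_lt => //; rewrite -/(cross x y) /k.
  by clear -lo; lia.
have k_le : (k <= cross x' y + 30 * (len + 2))%N by rewrite /k; clear -hi; lia.
have B_lt : (B x + 30 <= B x')%N by rewrite /B; clear -lt_xx'; lia.
have B'_le : (B x' <= 60 * X)%N by rewrite /B; clear -x'_lt; lia.
have z_ge : (Y * Y <= z)%N by rewrite /z -mulnn leq_mul ?leq_addr.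
have E_le : (30 * (len + 2) <= 30 * (62 * L))%N by clear -L_gt0; lia.
by apply: windows_disjoint_arith X_gt0 L_ge E_le _ k_gt k_le k'_le B_lt B'_le; rewrite -YE -mulnn.
Qed.

Lemma supercritical_fiber a :
  (\sum_(y < Y) \sum_(x < X) \sum_(i < len) (A x y i == a) <= L)%N.
Proof.
pose P y := (2 * (Y + y) ^ 2 < a <= 2 * (Y + y) ^ 2 + L * Y)%N.
apply: (@leq_trans (\sum_(y < Y) P y)); last first.
  apply: sum_bool_le_close => // y y' lt_yy' y'_lt /andP[_ a_le] /andP[a_gt _].
  have window_lt := leq_trans a_gt a_le; rewrite -!mulnn in window_lt.
  have [d y'E] : exists d, y' = (y + d)%N by exists (y' - y)%N; rewrite subnKC // ltnW.
  by rewrite y'E ltn_add2l -(ltn_pmul2r Y_gt0); clear -window_lt y'E; nia.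
apply: leq_sum => y _; have [_|not_P] := boolP (P y).
  apply: (@sum_bool_le1 X len (fun x i => A x y i == a)).
  move=> x x' i i' x_lt x'_lt i_lt i'_lt /eqP AE /eqP A'E.
  have xE : x = x'.
    have [lt_xx'|lt_x'x|//] := ltngtP x x'.
      by case: (@supercritical_disjoint x x' y i i'); rewrite ?AE.
    by case: (@supercritical_disjoint x' x y i' i); rewrite ?AE.
  split=> //; move: A'E; rewrite -AE xE /A => /eqP.
  by rewrite eqn_add2r eqn_mul2l /= eqn_add2l => /eqP.
rewrite big1 // => x _; rewrite big1 // => i _; apply/eqP; rewrite eqb0.
apply: contra not_P; rewrite /P => /eqP <-; rewrite supercritical_window // andbT.
by apply: leq_ltn_trans (supercritical_lower x y i); apply: leq_addr.
Qed.

Lemma sum_large_sq_divisors :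
  (\sum_(x < X) \sum_(y < Y) \sum_(i < len) sq_divisors L.+1 (4 * Y) (A x y i))%:R
    <= L%:R * (16 * Y%:R ^+ 2 / (2 * L%:R) + 4 * Y%:R) :> rat.
Proof.
have [M ME] : exists M, M = (16 * Y ^ 2)%N by eexists.
pose I := ('I_Y * ('I_X * 'I_len))%type.
have sum_pairs (G : nat -> nat -> nat -> nat) :
    (\sum_(y < Y) \sum_(x < X) \sum_(i < len) G x y i = \sum_(z : I) G z.2.1 z.1 z.2.2)%N.
  by under eq_bigr => y _ do rewrite pair_big /=; rewrite pair_big.
rewrite exchange_big /= (sum_pairs (fun x y i => sq_divisors L.+1 (4 * Y) (A x y i))).
have A_lt (z : I) : (A z.2.1 z.1 z.2.2 < M)%N by rewrite ME supercritical_lt.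
have fiber_le a : (\sum_(z : I) (A z.2.1 z.1 z.2.2 == a) <= L)%N.
  by rewrite -(sum_pairs (fun x y i => A x y i == a : nat)) supercritical_fiber.
have := sum_comp_le (sq_divisors L.+1 (4 * Y)) A_lt fiber_le.
rewrite -(ler_nat rat) natrM => /le_trans; apply; apply: ler_wpM2l; first exact: ler0n.
have id_bound : sieve_bound 1 (fun a => 1 * a + 0)%N M by apply: sieve_bound_linear.
have -> : (\sum_(a < M) sq_divisors L.+1 (4 * Y) a =
    \sum_(a < M) sq_divisors L.+1 (4 * Y) (1 * a + 0))%N.
  by apply: eq_bigr => a _; rewrite mul1n addn0.
have L_ge6 : (6 <= L)%N by apply: leq_trans L_ge.
apply: le_trans (sum_sq_divisors_le _ L_ge6 ler01 id_bound) _.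
rewrite mul1r ME natrM natrX lerD2l -(natrM _ 4) ler_nat; exact: primepi_le_self.
Qed.

Lemma sum_small_sq_divisors :
  (\sum_(x < X) \sum_(y < Y) \sum_(i < len) sq_divisors 7 L.+1 (A x y i))%:R
    <= X%:R * Y%:R * (len%:R / 12 + (L%:R + 1)) :> rat.
Proof.
have inner_le (x y : nat) :
    (\sum_(i < len) sq_divisors 7 L.+1 (A x y i))%:R <= len%:R / 12 + (L%:R + 1) :> rat.
  apply: le_trans (sum_sq_divisors7_le L.+1 ler01 (@supercritical_bound x y len)) _.
  by rewrite mul1r lerD2l natr1 ler_nat primepi_le_self.
move: (len%:R / 12 + (L%:R + 1)) inner_le => c inner_le; rewrite natr_sum.
apply: (@le_trans _ _ (\sum_(x < X) \sum_(y < Y) c)).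
  by apply: ler_sum => x _; rewrite natr_sum; apply: ler_sum => y _; apply: inner_le.
by rewrite !sumr_const !card_ord -[leLHS]mulr_natl -[c *+ _]mulr_natl mulrA.
Qed.

Lemma sum_supercritical_common :
  (\sum_(y < Y) \sum_(x < X) \sum_(i < len)
     common_divisors (16 * Y ^ 2) (B x ^ 2 + 1) (A x y i))%:R
    <= Y%:R * (len%:R * X%:R / 3 + 4 * len%:R * J%:R + 2 * X%:R * J%:R) :> rat.
Proof.
have inner_le (y : nat) :
    (\sum_(x < X) \sum_(i < len) common_divisors (16 * Y ^ 2) (B x ^ 2 + 1) (A x y i))%:R
      <= len%:R * X%:R / 3 + 4 * len%:R * J%:R + 2 * X%:R * J%:R :> rat.
  apply: (sum_common_divisors_le (f := fun x => (B x ^ 2 + 1)%N) (v := fun x i => A x y i)).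
  - exact: sieve_bound_sqr_succ.
  - exact: J_ge.
  - move=> x x_lt; rewrite addn1 /=; apply: leq_trans J_ge.
    have : (X * (200 * 1000) <= Y)%N by rewrite YE mulnC leq_mul2r L_ge orbT.
    by rewrite /B -!mulnn; clear -x_lt X_ge; nia.
  - by move=> x; apply: sieve_bound_le (@supercritical_bound x y len).
rewrite natr_sum; apply: le_trans (ler_sum _ (fun (y : 'I_Y) _ => inner_le y)) _.
by rewrite sumr_const card_ord -[leLHS]mulr_natl.
Qed.

Lemma exists_sieved_supercritical : exists x y i : nat,
  [/\ (x < X)%N /\ (y < Y)%N, (i < len)%N, sq_divisors 7 NB (B x ^ 2 + 1) = 0%N,
      sq_divisors 7 (4 * Y) (A x y i) = 0%N &
      common_divisors (16 * Y ^ 2) (B x ^ 2 + 1) (A x y i) = 0%N].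
Proof.
pose sqB x := sq_divisors 7 NB (B x ^ 2 + 1).
pose small x y i := sq_divisors 7 L.+1 (A x y i).
pose large x y i := sq_divisors L.+1 (4 * Y) (A x y i).
pose common x y i := common_divisors (16 * Y ^ 2) (B x ^ 2 + 1) (A x y i).
pose defects x y i := (sqB x + small x y i + large x y i + common x y i)%N.
suff [x x_lt plane_lt] : exists2 x, (x < X)%N &
    (\sum_(y < Y) \sum_(i < len) defects x y i < Y * len)%N.
  have [y y_lt row_lt] :=
    exists_lt_of_sum_lt (G := fun y => \sum_(i < len) defects x y i)%N plane_lt.
  have [i i_lt /eqP] := exists_zero_of_sum_lt (G := defects x y) row_lt.
  rewrite !addn_eq0 => /andP[/andP[/andP[/eqP sqB_0 /eqP small_0] /eqP large_0] /eqP common_0].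
  exists x, y, i; split=> //.
  have [le_7L le_LY] : (7 <= L.+1)%N /\ (L.+1 <= 4 * Y)%N.
    by split; [apply: leq_trans (leqW L_ge) | clear -L_gt0 L_le_Y; lia].
  by rewrite (sq_divisors_cat _ le_7L le_LY) -/(small x y i) -/(large x y i) small_0 large_0.
apply: (exists_lt_of_sum_lt (G := fun x => \sum_(y < Y) \sum_(i < len) defects x y i)%N).
have -> : (\sum_(x < X) \sum_(y < Y) \sum_(i < len) defects x y i =
   Y * len * \sum_(x < X) sqB x + \sum_(x < X) \sum_(y < Y) \sum_(i < len) small x y i +
   \sum_(x < X) \sum_(y < Y) \sum_(i < len) large x y i +
   \sum_(y < Y) \sum_(x < X) \sum_(i < len) common x y i)%N.
  rewrite [X in (_ = _ + X)%N]exchange_big /= big_distrr /= -!big_split /=.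
  apply: eq_bigr => x _.
  have -> : (Y * len * sqB x = \sum_(y < Y) \sum_(i < len) sqB x)%N.
    by rewrite !sum_nat_const !card_ord -mulnA.
  by rewrite -!big_split /=; apply: eq_bigr => y _; rewrite -!big_split.
have sqB_le : (\sum_(x < X) sqB x)%:R <= 2 * (X%:R / 12 + (primepi NB)%:R) :> rat.
  exact: sum_sq_divisors7_le (ler0n _ 2) (@sieve_bound_sqr_succ X X).
rewrite -(ltr_nat rat) !natrD (natrM _ (Y * len)) (natrM _ X) (natrM _ Y len).
have YL_ge0 : 0 <= Y%:R * len%:R :> rat by rewrite mulr_ge0 ?ler0n.
apply: le_lt_trans (lerD (lerD (lerD (ler_wpM2l YL_ge0 sqB_le) sum_small_sq_divisors)
  sum_large_sq_divisors) sum_supercritical_common) _.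
have -> : len%:R = 60 * L%:R :> rat by rewrite natrM.
apply: supercritical_budget.
- by rewrite YE natrM.
- by have := X_ge; rewrite -(ler_nat rat).
- by rewrite (ler_nat _ 1000) (leq_trans _ L_ge).
- by have := pi_le; rewrite -(ler_nat rat) {2}NBE; lra.
- by have := JX; rewrite -(ler_nat rat) natrM.
by have := JL; rewrite -(ler_nat rat) natrM.
Qed.

Lemma exists_admissible_supercritical C : (200 * 1000 <= C)%N ->
  exists A' B' y k : nat, [/\ admissible C A' B' y k,
    (X <= B')%N /\ (B' <= C * X)%N & (Y ^ 2 <= A')%N /\ (A' <= C * Y ^ 2)%N].
Proof.
move=> C_ge; have [x [y [i [[x_lt y_lt] i_lt B_sq A_sq AB_common]]]] := exists_sieved_supercritical.
have lo := supercritical_lower x y i; have hi := supercritical_upper x y i_lt.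
have A_lt := supercritical_lt x y_lt i_lt.
have A_gt0 : (0 < A x y i)%N by rewrite /A addn1.
have co_A30 : coprime (A x y i) 30 by rewrite -coprime_modl /A mulnC modnMDl.
have B_le : (B x <= 60 * X)%N by rewrite /B; clear -x_lt; lia.
pose z := (Y + y)%N; pose k := (A x y i - 2 * z ^ 2)%N.
have z2_le : (2 * z ^ 2 <= A x y i)%N by apply: leq_trans (leq_addr _ _) (ltnW lo).
have AE : A x y i = (2 * z ^ 2 + k)%N by rewrite /k subnKC.
have k_gt : (cross x y < k)%N by rewrite /k ltn_subRL.
have k_le : (k <= cross x y + 30 * (len + 2))%N by rewrite /k leq_subLR addnA.
exists (A x y i), (B x), z, k; split.
- apply: (admissible_of_sieve co_A30 _ _ A_sq B_sq _ AE).
  + by rewrite A_gt0 expnMn.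
  + by rewrite NBE -/(B x) -!mulnn; clear -B_le X_gt0; nia.
  + have A_range : (0 < A x y i < 16 * Y ^ 2)%N by rewrite A_gt0.
    apply: coprime_of_common_divisors A_range _ co_A30 _; first by rewrite addn1.
    by rewrite common_divisorsC.
  + by rewrite /z addn_gt0 Y_gt0.
  apply/andP; split.
    apply: (@leq_trans (A x y i ^ 2)); first by rewrite leq_exp2r // leq_subr.
    by have := @crossing_lt _ z _ (B_ge2 x) k_gt; rewrite -AE; apply: ltnW.
  have := crossing_add_le (B x) z (k - cross x y).
  rewrite subnKC ?(ltnW k_gt) // => /leq_trans; apply.
  rewrite leq_exp2r //; apply: leq_add; first exact: ltnW.
  apply: (@leq_trans (30 * (62 * L) * (61 * X))).
    apply: leq_mul; last by clear -B_le X_ge; lia.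
    by rewrite leq_subLR; apply: leq_trans k_le _; rewrite leq_add2l; clear -L_gt0; lia.
  apply: (@leq_trans (200 * 1000 * Y)); first by rewrite YE; clear; lia.
  by apply: leq_mul => //; rewrite leq_addr.
- split; first by rewrite /B; clear; lia.
  by apply: leq_trans B_le _; rewrite leq_mul2r; apply/orP; right; clear -C_ge; lia.
split; first by apply: leq_trans z2_le; rewrite /z -!mulnn; clear; nia.
by apply: leq_trans (ltnW A_lt) _; rewrite leq_mul2r; apply/orP; right; clear -C_ge; lia.
Qed.

End Supercritical.

Lemma abundant_supercritical (m n : nat) :
  (0 < m)%N -> (2 * m < n)%N -> abundant_parameters m n.
Proof.
move=> m_gt0 n_gt_2m.
have [N0 pi_le] := @primepi_density (10 * 1000) isT.
have [C C_ge] : exists C, (200 * 1000 <= C)%N by eexists; apply: leqnn.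
have C_gt0 : (0 < C)%N by apply: leq_trans C_ge.
exists C => // T0.
have [j [j_gt0 N_le cj_le]] :=
  exists_exponent (400 + 400 * n) (T0 + N0 + 200 * 1000) (isT : 4 <= 4)%N.
have [t tE] : exists t, t = (4 ^ j)%N by eexists.
rewrite -tE in N_le cj_le; have t_gt0 : (0 < t)%N by rewrite tE expn_gt0.
have [L LE] : exists L, L = (t ^ (n - 2 * m))%N by eexists.
have [X XE] : exists X, X = (t ^ (2 * m))%N by eexists.
have [Y YE] : exists Y, Y = (t ^ n)%N by eexists.
pose J := (4 + 4 * (j * n))%N.
have t_le_X : (t <= X)%N by rewrite XE leq_self_exp // muln_gt0.
have t_le_L : (t <= L)%N by rewrite LE leq_self_exp // subn_gt0.
have J_le : (100 * J <= t)%N by apply: leq_trans cj_le; rewrite /J; clear -j_gt0; nia.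
have YLX : Y = (L * X)%N by rewrite YE LE XE -expnD; congr expn; clear -n_gt_2m; lia.
have J_ge : (16 * Y ^ 2 <= 2 ^ J)%N.
  have -> : (Y ^ 2 = (4 ^ 2) ^ (j * n))%N.
    by rewrite YE tE -!expnM; congr (4 ^ _)%N; clear; lia.
  by rewrite /J expnD (expnM 2 4) leq_mul.
have piB_le : (10 * 1000 * primepi (100 * X) <= 100 * X)%N.
  by apply: pi_le; clear -N_le t_le_X; lia.
have [||A [B [y [k [ABk_adm [B_ge B_le] [A_ge A_le]]]]]] := exists_admissible_supercritical YLX
  _ _ erefl piB_le J_ge (leq_trans J_le t_le_X) (leq_trans J_le t_le_L) C_ge.
- by clear -N_le t_le_X; lia.
- by clear -N_le t_le_L; lia.
have X_pow : X = ((t ^ 2) ^ m)%N by rewrite XE expnM.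
have Y2E : (Y ^ 2 = (t ^ 2) ^ n)%N by rewrite YE -!expnM mulnC.
exists (t ^ 2)%N, A, B, y, k; split=> //.
- by apply: leq_trans (leq_self_exp t_gt0 (isT : 0 < 2)%N); clear -N_le; lia.
- by rewrite -X_pow; apply: commensurate_nat => //; apply: leq_trans B_ge _; rewrite leq_pmull.
- by rewrite -Y2E; apply: commensurate_nat => //; apply: leq_trans A_ge _; rewrite leq_pmull.
Qed.

Lemma abundant (m n : nat) : (0 < m)%N -> (m <= n)%N -> abundant_parameters m n.
Proof.
move=> m_gt0 le_mn; have [n_lt|n_gt|->] := ltngtP n (2 * m)%N.
- exact: abundant_subcritical.
- exact: abundant_supercritical.
- exact: abundant_critical.
Qed.

Unset Implicit Arguments.

Theorem theorem1p3 (r : rat) :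
  ABC -> 1 / 4 <= r -> r < 1 / 2 ->
  exists c1 c2 : algC, 0 < c1 /\ 0 < c2 /\
  exists theta : nat -> algC,
    (forall n m : nat, n <> m -> ~ (forall x, nfield (theta n) x <-> nfield (theta m) x)) /\
    (forall n : nat,
       totally_real (nfield (theta n)) /\ cyclic_quartic (theta n) /\
       exists D M : algC, abs_disc (nfield (theta n)) D /\ mahler_OK (nfield (theta n)) M /\
         c1 * rpow D r <= M /\ M <= c2 * rpow D r).
Proof.
move=> _ r_ge r_lt; have [q_le p_lt] := exponents_of_rat r_ge r_lt.
have [|c c_gt0 [theta [M [field_M M_incr]]]] := balanced_fields_of_abundant q_le p_lt.
  by apply: abundant; lia.
have c_gt0' : 0 < c%:R :> algC by rewrite ltr0n.
exists c%:R^-1, c%:R; split; first by rewrite invr_gt0.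
split=> //; exists theta; split=> [n m n_neq_m same|n].
  have [_ _ M_n _] := field_M n; have [_ _ M_m _] := field_M m.
  have M_eq := mahler_OK_unique same M_n M_m.
  by have [/M_incr|/M_incr|//] := ltngtP n m; rewrite M_eq ltxx.
have [theta_real theta_cyclic M_n [D D_disc [_ _ D_le M_le]]] := field_M n.
do 2!split=> //; exists D, (M n); do 2!split=> //; split=> //.
by rewrite mulrC ler_pdivrMr // mulrC.
Qed.
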